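(* Let $\kappa$ be a perfect field, let $r, m, n \geq 2$ be integers, and let $X_\ell = (x^\ell_{ij})$, $1 \leq \ell \leq r$, be $r$ matrices of size $m \times n$ whose entries are $rmn$ distinct indeterminates. Let $R = \kappa[x^\ell_{ij} \mid 1 \leq i \leq m,\ 1 \leq j \leq n,\ 1 \leq \ell \leq r]$ with the standard grading, let $H$ be the $m \times rn$ horizontal concatenation and $V$ the $rm \times n$ vertical concatenation of $X_1,\dots,X_r$, let $I = I_2(H) + I_2(V) \subseteq R$, and let $\mathcal{X}$ be the toric double determinantal variety cut out by $I$. Then $\mathcal{X}$ is smooth as a projective variety; that is, the localization of its homogeneous coordinate ring $S = R/I$ at every homogeneous prime ideal other than the homogeneous maximal ideal (generated by the images of all the $x^\ell_{ij}$) is a regular local ring.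
   Context: For a matrix $M$ with entries in a commutative ring and a positive integer $a$, $I_a(M)$ denotes the ideal generated by the $a$-minors (determinants of $a \times a$ submatrices) of $M$. The horizontal concatenation is $H = \begin{bmatrix} X_1 & \cdots & X_r \end{bmatrix}$ and the vertical concatenation is $V = \begin{bmatrix} X_1 \\ \vdots \\ X_r \end{bmatrix}$. A toric double determinantal variety is the variety defined by the homogeneous ideal $I = I_2(H)+I_2(V)$. A projective variety over the perfect field $\kappa$ is called smooth here when its homogeneous coordinate ring is regular at the localization at every non-maximal homogeneous prime. *)

(* Defs.v *)
From HB Require Import structures.
From mathcomp Require Import all_boot all_algebra.
From mathcomp Require Import generic_quotient ring_quotient separable.
From mathcomp Require Import boolp ring mpoly.

Set Implicit Arguments.
Unset Strict Implicit.
Unset Printing Implicit Defensive.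

Import GRing.Theory.
Local Open Scope ring_scope.
Local Open Scope quotient_scope.

Definition perfect_field (K : fieldType) : Prop :=
  forall p : {poly K}, irreducible_poly p -> separable_poly p.

Section Ideals.
Variable A : comNzRingType.

Definition ideal_gen (X : A -> Prop) : {pred A} :=
  [pred x | `[< exists k (a g : 'I_k -> A),
                  (forall i, X (g i)) /\ x = \sum_(i < k) a i * g i >]].

Definition ideal_add (I J : {pred A}) : {pred A} :=
  [pred x | `[< exists y z, [/\ y \in I, z \in J & x = y + z] >]].

Lemma ideal_genP (X : A -> Prop) x :
  reflect (exists k (a g : 'I_k -> A),
             (forall i, X (g i)) /\ x = \sum_(i < k) a i * g i)
          (x \in ideal_gen X).
Proof. exact: asboolP. Qed.

Lemma ideal_addP (I J : {pred A}) x :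
  reflect (exists y z, [/\ y \in I, z \in J & x = y + z]) (x \in ideal_add I J).
Proof. exact: asboolP. Qed.

Lemma ideal_gen0 (X : A -> Prop) : 0 \in ideal_gen X.
Proof.
by apply/ideal_genP; exists 0, (fun=> 0), (fun=> 0); split=> [[]|]; rewrite ?big_ord0.
Qed.

Lemma ideal_genMD (X : A -> Prop) c :
  {in ideal_gen X &, forall u v, c * u + v \in ideal_gen X}.
Proof.
move=> u v /ideal_genP[k [a [g [Xg ->]]]] /ideal_genP[l [b [h [Xh ->]]]].
apply/ideal_genP; exists (k + l)%N.
exists (fun i => match split i with inl i => c * a i | inr j => b j end).
exists (fun i => match split i with inl i => g i | inr j => h j end).
split=> [i|]; first by case: (split i).
rewrite big_split_ord /= mulr_sumr; congr (_ + _); apply: eq_bigr => i _.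
  by case: split_ordP => j ej; [rewrite (lshift_inj ej) mulrA
                                | move/eqP: ej; rewrite eq_lrshift].
by case: split_ordP => j ej; [move/eqP: ej; rewrite eq_rlshift
                              | rewrite (rshift_inj ej)].
Qed.

(* [idealr A] is the library's type of proper ideals; the unit ideal, which it
   excludes, is always finitely generated. *)
Definition noetherian : Prop :=
  forall J : idealr A, exists s : seq A, J =i ideal_gen (fun x => x \in s).

Definition maximal_ideal (M : idealr A) : Prop :=
  forall J : idealr A, {subset M <= J} -> J =i M.

Definition unique_maximal_ideal (M : idealr A) : Prop :=
  maximal_ideal M /\ forall N : idealr A, maximal_ideal N -> N =i M.

Definition prime_chain (d : nat) (c : 'I_d.+1 -> prime_idealr A) : Prop :=
  forall i j : 'I_d.+1, (i < j)%N ->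
    {subset c i <= c j} /\ exists2 x, x \in c j & x \notin c i.

Definition krull_dim (d : nat) : Prop :=
  (exists c : 'I_d.+1 -> prime_idealr A, prime_chain c) /\
  (forall e (c : 'I_e.+1 -> prime_idealr A), prime_chain c -> (e <= d)%N).

Definition regular_local_ring : Prop :=
  noetherian /\
  exists M : idealr A, unique_maximal_ideal M /\
    exists d, krull_dim d /\
      exists s : d.-tuple A, M =i ideal_gen (fun x => x \in s).

End Ideals.

Section Localization.
Variables (A : comNzRingType) (P : prime_idealr A).

Definition fracs := {x : A * A | x.2 \notin P}.
Definition fnum (x : fracs) : A := (val x).1.
Definition fden (x : fracs) : A := (val x).2.

Lemma fdenP x : fden x \notin P. Proof. exact: valP x. Qed.

Lemma notin_prime1 : (1 : A) \notin P. Proof. by rewrite idealr1. Qed.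

Lemma notin_primeM (u v : A) : u \notin P -> v \notin P -> u * v \notin P.
Proof. by move=> uP vP; rewrite prime_idealrM negb_or uP. Qed.

Definition mkfrac (a b : A) (bP : b \notin P) : fracs :=
  exist (fun x : A * A => x.2 \notin P) (a, b) bP.

(* The factor u is needed because A may have zero divisors. *)
Definition locequiv (x y : fracs) : bool :=
  `[< exists2 u, u \notin P & u * (fnum x * fden y - fnum y * fden x) = 0 >].

Lemma locequivP x y :
  reflect (exists2 u, u \notin P & u * (fnum x * fden y - fnum y * fden x) = 0)
          (locequiv x y).
Proof. exact: asboolP. Qed.

Lemma locequiv_is_equiv : equiv_class_of locequiv.
Proof.
split=> [x|x y|y x z].
- by apply/locequivP; exists 1; rewrite ?notin_prime1 // subrr mulr0.
- by apply/locequivP/locequivP=> -[u uP e]; exists u => //;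
    rewrite -opprB mulrN e oppr0.
- move=> /locequivP[u uP e] /locequivP[v vP f]; apply/locequivP.
  exists (u * v * fden y); first by rewrite !notin_primeM ?fdenP.
  have -> : u * v * fden y * (fnum x * fden z - fnum z * fden x) =
     v * fden z * (u * (fnum x * fden y - fnum y * fden x))
     + u * fden x * (v * (fnum y * fden z - fnum z * fden y)) by ring.
  by rewrite e f !mulr0 addr0.
Qed.

Canonical locequiv_equiv := EquivRelPack locequiv_is_equiv.
Canonical locequiv_encModRel := defaultEncModRel locequiv.

Definition localization := {eq_quot locequiv}.

HB.instance Definition _ : EqQuotient fracs locequiv localization :=
  EqQuotient.on localization.
HB.instance Definition _ := Choice.on localization.

Definition add_frac (x y : fracs) : fracs :=
  mkfrac (fnum x * fden y + fnum y * fden x) (notin_primeM (fdenP x) (fdenP y)).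
Definition opp_frac (x : fracs) : fracs := mkfrac (- fnum x) (fdenP x).
Definition mul_frac (x y : fracs) : fracs :=
  mkfrac (fnum x * fnum y) (notin_primeM (fdenP x) (fdenP y)).

Definition locadd := lift_op2 localization add_frac.
Definition locopp := lift_op1 localization opp_frac.
Definition locmul := lift_op2 localization mul_frac.
Definition loczero : localization := \pi_localization (mkfrac 0 notin_prime1).
Definition locone : localization := \pi_localization (mkfrac 1 notin_prime1).

Lemma locpiP (x y : fracs) :
  (exists2 u, u \notin P & u * (fnum x * fden y - fnum y * fden x) = 0) <->
  \pi_localization x = \pi_localization y.
Proof.
split=> [h|/eqP]; first by apply/eqP; rewrite piE; apply/locequivP.
by rewrite piE => /locequivP.
Qed.

Lemma pi_locadd : {morph \pi_localization : x y / add_frac x y >-> locadd x y}.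
Proof.
move=> x y; unlock locadd; apply/locpiP.
have /locpiP[u uP e] : \pi_localization x = \pi_localization (repr (\pi_localization x)).
  by rewrite reprK.
have /locpiP[v vP f] : \pi_localization y = \pi_localization (repr (\pi_localization y)).
  by rewrite reprK.
move: (repr _) e (repr _) f => x' e y' f.
exists (u * v); rewrite ?notin_primeM // /fnum /fden /= -!/(fnum _) -!/(fden _).
transitivity (v * fden y * fden y' * (u * (fnum x * fden x' - fnum x' * fden x))
   + u * fden x * fden x' * (v * (fnum y * fden y' - fnum y' * fden y))); first by ring.
by rewrite e f !mulr0 addr0.
Qed.

Lemma pi_locopp : {morph \pi_localization : x / opp_frac x >-> locopp x}.
Proof.
move=> x; unlock locopp; apply/locpiP.
have /locpiP[u uP e] : \pi_localization x = \pi_localization (repr (\pi_localization x)).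
  by rewrite reprK.
move: (repr _) e => x' e.
exists u; rewrite // /fnum /fden /= -!/(fnum _) -!/(fden _).
transitivity (- (u * (fnum x * fden x' - fnum x' * fden x))); first by ring.
by rewrite e oppr0.
Qed.

Lemma pi_locmul : {morph \pi_localization : x y / mul_frac x y >-> locmul x y}.
Proof.
move=> x y; unlock locmul; apply/locpiP.
have /locpiP[u uP e] : \pi_localization x = \pi_localization (repr (\pi_localization x)).
  by rewrite reprK.
have /locpiP[v vP f] : \pi_localization y = \pi_localization (repr (\pi_localization y)).
  by rewrite reprK.
move: (repr _) e (repr _) f => x' e y' f.
exists (u * v); rewrite ?notin_primeM // /fnum /fden /= -!/(fnum _) -!/(fden _).
transitivity (v * fnum y * fden y' * (u * (fnum x * fden x' - fnum x' * fden x))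
   + u * fnum x' * fden x * (v * (fnum y * fden y' - fnum y' * fden y))); first by ring.
by rewrite e f !mulr0 addr0.
Qed.

Lemma locpi_eq (x y : fracs) : fnum x * fden y = fnum y * fden x ->
  \pi_localization x = \pi_localization y.
Proof.
by move=> e; apply/locpiP; exists 1; rewrite ?notin_prime1 // e subrr mulr0.
Qed.

Local Ltac frac_eq := apply: locpi_eq; do 2 rewrite /fnum /fden /=; ring.

Lemma locaddA : associative locadd.
Proof.
elim/quotW=> x; elim/quotW=> y; elim/quotW=> z.
by rewrite -!pi_locadd; frac_eq.
Qed.
Lemma locaddC : commutative locadd.
Proof.
by elim/quotW=> x; elim/quotW=> y; rewrite -!pi_locadd; frac_eq.
Qed.
Lemma locadd0 : left_id loczero locadd.
Proof. by elim/quotW=> x; rewrite -!pi_locadd; frac_eq. Qed.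
Lemma locaddN : left_inverse loczero locopp locadd.
Proof. by elim/quotW=> x; rewrite -pi_locopp -!pi_locadd; frac_eq. Qed.
Lemma locmulA : associative locmul.
Proof.
elim/quotW=> x; elim/quotW=> y; elim/quotW=> z.
by rewrite -!pi_locmul; frac_eq.
Qed.
Lemma locmulC : commutative locmul.
Proof.
by elim/quotW=> x; elim/quotW=> y; rewrite -!pi_locmul; frac_eq.
Qed.
Lemma locmul1 : left_id locone locmul.
Proof. by elim/quotW=> x; rewrite -!pi_locmul; frac_eq. Qed.
Lemma locmul_add : left_distributive locmul locadd.
Proof.
elim/quotW=> x; elim/quotW=> y; elim/quotW=> z.
by rewrite -!(pi_locadd, pi_locmul); frac_eq.
Qed.
Lemma locone_neq0 : locone != loczero.
Proof.
apply/eqP=> /locpiP[u uP]; rewrite /fnum /fden /= mul0r subr0 !mulr1 => u0.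
by rewrite u0 idealr0 in uP.
Qed.

HB.instance Definition _ :=
  GRing.isZmodule.Build localization locaddA locaddC locadd0 locaddN.
HB.instance Definition _ := GRing.Zmodule_isComNzRing.Build localization
  locmulA locmulC locmul1 locmul_add locone_neq0.

End Localization.

Section Projective.
Variables (K : fieldType) (N : nat) (I : idealr {mpoly K[N]}).

Local Notation S := {ideal_quot I}.

Definition homogeneous_elt (s : S) : Prop :=
  exists e (p : {mpoly K[N]}), p \is e.-homog /\ s = \pi_S p.

Definition homogeneous_ideal (J : {pred S}) : Prop :=
  J =i ideal_gen (fun s => s \in J /\ homogeneous_elt s).

Definition homogeneous_maximal_ideal : {pred S} :=
  ideal_gen (fun s => exists i, s = \pi_S 'X_i).

(* Smoothness of the projective variety Proj S over a perfect field, read on the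
   homogeneous coordinate ring S = K[x]/I; perfectness of K is not assumed
   here but in the theorem. *)
Definition smooth_projective : Prop :=
  forall P : prime_idealr S,
    homogeneous_ideal P -> ~ (P =i homogeneous_maximal_ideal) ->
    regular_local_ring (localization P).

End Projective.

Section Minors.
Variables (A : comNzRingType) (a p q : nat) (M : 'M[A]_(p, q)).

(* Submatrices are given by strictly increasing choices of rows and columns. *)
Definition is_minor (x : A) : Prop :=
  exists (f : 'I_a -> 'I_p) (g : 'I_a -> 'I_q),
    [/\ {homo f : i j / (i < j)%N}, {homo g : i j / (i < j)%N}
      & x = \det (mxsub f g M)].

Definition minors_ideal : {pred A} := ideal_gen is_minor.

End Minors.

Section DoubleDeterminantal.
Variables (K : fieldType) (r m n : nat).

Definition ddet_nvars : nat := #|{: 'I_r * 'I_m * 'I_n}|.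

Local Notation R := {mpoly K[ddet_nvars]}.

Definition ddet_mx (l : 'I_r) : 'M[R]_(m, n) :=
  \matrix_(i, j) 'X_(enum_rank (l, i, j)).

Definition ddet_H : 'M[R]_(m, \sum_(l < r) n) := \mxrow_(l < r) ddet_mx l.
Definition ddet_V : 'M[R]_(\sum_(l < r) m, n) := \mxcol_(l < r) ddet_mx l.

Definition toric_ddet_ideal : {pred R} :=
  ideal_add (minors_ideal 2 ddet_H) (minors_ideal 2 ddet_V).

Lemma minors_ideal_eval0 p q (M : 'M[R]_(p, q)) x :
  (forall i j, meval (fun=> 0) (M i j) = 0) ->
  x \in minors_ideal 2 M -> meval (fun=> 0) x = 0.
Proof.
move=> M0 /ideal_genP[k [a [g [gM ->]]]]; rewrite rmorph_sum big1 // => i _.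
have [f [h [_ _ ->]]] := gM i; rewrite rmorphM -det_map_mx /=.
suff -> : map_mx (meval (fun=> 0)) (mxsub f h M) = 0 by rewrite det0 mulr0.
by apply/matrixP=> u v; rewrite !mxE M0.
Qed.

Lemma toric_ddet_idealr_closed : idealr_closed toric_ddet_ideal.
Proof.
split.
- by apply/ideal_addP; exists 0, 0; rewrite !ideal_gen0 addr0.
- apply/negP=> /ideal_addP[y [z [yH zV]]].
  move=> /(congr1 (meval (fun=> (0 : K)))); rewrite rmorphD rmorph1 /=.
  rewrite (minors_ideal_eval0 _ yH) ?(minors_ideal_eval0 _ zV) ?addr0.
  + by move/eqP; rewrite oner_eq0.
  + by move=> i j; rewrite !mxE mevalXU.
  + by move=> i j; rewrite !mxE mevalXU.
- move=> c _ _ /ideal_addP[y [z [yH zV ->]]] /ideal_addP[y' [z' [yH' zV' ->]]].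
  apply/ideal_addP; exists (c * y + y'), (c * z + z').
  by split; [exact: ideal_genMD | exact: ideal_genMD | ring].
Qed.

HB.instance Definition _ :=
  isIdealr.Build R toric_ddet_ideal toric_ddet_idealr_closed.

End DoubleDeterminantal.

Arguments toric_ddet_ideal : clear implicits.

(* Main.v *)
From HB Require Import structures.
Require Import Defs.
From mathcomp Require Import all_boot all_order all_algebra.
From mathcomp Require Import generic_quotient ring_quotient fraction.
From mathcomp Require Import boolp ring mpoly.

(** The affine cone over the variety, without its vertex, is covered by charts
    isomorphic to open parts of an affine space. A prime P of S other than the
    irrelevant ideal misses some variable x, the entry at a position (l0, i0, j0)
    say ([variable_notin_prime]). Once x is inverted, the two-minors of H and V express
    every entry as x^-2 a_i b_j c_l ([coord_monomial]), where a_i, b_j, c_l are the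
    entries whose position differs from (l0, i0, j0) in the row, the column or the
    block only. These entries and x are algebraically independent, as the
    substitution of x^-2 a_i b_j c_l for every entry gives matrices H and V of rank
    one, and so kills I ([parametrization_ideal]). Hence the localization of S at P
    is the localization of a polynomial ring T over K at a prime Q
    ([chart_localization]).

    It remains that polynomial rings over a field have regular local rings
    ([regular_mpoly_localization]). They are noetherian ([noetherian_poly]). By
    induction on the number n of variables, each prime Q of T comes with an integer
    d, a chain of d + 1 primes ending at Q, d elements generating Q after
    localization, and n - d elements of T that are algebraically independent modulo
    Q ([regular_dim_poly]): adding a variable, Q either is extended from its
    contraction, or needs exactly one more generator.

    The bound on the length e of all chains of primes ending at Q does not go
    through the principal ideal theorem. Picking one element in each step of such a
    chain prolongs the n - d independent elements to e + n - d elements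
    independent modulo the smallest prime ([indep_chain]). Counting monomials
    against the growth of T shows that at most n elements can be independent
    ([indep_size_le]), so that e <= d. *)

Set Implicit Arguments.
Unset Strict Implicit.
Unset Printing Implicit Defensive.

Import GRing.Theory.
Local Open Scope ring_scope.
Local Open Scope quotient_scope.

(** * Ideals as propositional predicates *)

Section PropIdeals.
Variable A : comNzRingType.
Implicit Types (J P Q : A -> Prop) (a b x y : A).

(** The unit ideal is included, unlike for the packaged [idealr]: the leading
    coefficients of an ideal of polynomials may well generate everything. *)
Definition is_ideal J := J 0 /\ forall c x y, J x -> J y -> J (c * x + y).

Definition is_prime P :=
  [/\ is_ideal P, ~ P 1 & forall x y, P (x * y) -> P x \/ P y].

Lemma ideal_add_closed J x y : is_ideal J -> J x -> J y -> J (x + y).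
Proof. by move=> [_ IJ] Jx Jy; rewrite -[x]mul1r; exact: IJ. Qed.

Lemma ideal_mulr J c x : is_ideal J -> J x -> J (c * x).
Proof. by move=> [J0 IJ] Jx; rewrite -[c * x]addr0; exact: IJ. Qed.

Lemma ideal_opp J x : is_ideal J -> J x -> J (- x).
Proof. by move=> IJ Jx; rewrite -mulN1r; exact: ideal_mulr. Qed.

Lemma ideal_sub J x y : is_ideal J -> J x -> J y -> J (x - y).
Proof. by move=> IJ Jx Jy; apply: ideal_add_closed => //; exact: ideal_opp. Qed.

Lemma ideal_addl J x y : is_ideal J -> J x -> J (x + y) -> J y.
Proof. by move=> IJ Jx /ideal_sub/(_ Jx); rewrite addrC addKr; exact. Qed.

Lemma ideal_sum J (I : finType) (F : I -> A) :
  is_ideal J -> (forall i, J (F i)) -> J (\sum_i F i).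
Proof.
move=> IJ JF; elim/big_rec: _ => [|i x _]; first by case: IJ.
exact: ideal_add_closed.
Qed.

Lemma ideal_gen_min J (G : A -> Prop) x :
  is_ideal J -> (forall g, G g -> J g) -> x \in ideal_gen G -> J x.
Proof.
move=> IJ GJ /ideal_genP[k [a [g [Gg ->]]]].
by apply: ideal_sum => // i; apply: ideal_mulr => //; apply: GJ.
Qed.

Lemma is_ideal_gen (G : A -> Prop) : is_ideal (fun x => x \in ideal_gen G).
Proof. by split=> [|c x y]; [exact: ideal_gen0 | exact: ideal_genMD]. Qed.

Lemma mem_ideal_gen (G : A -> Prop) x : G x -> x \in ideal_gen G.
Proof.
move=> Gx; apply/ideal_genP; exists 1, (fun=> 1), (fun=> x); split=> //.
by rewrite big_ord1 mul1r.
Qed.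

Lemma ideal_gen_sub (G H : A -> Prop) x :
  (forall g, G g -> g \in ideal_gen H) -> x \in ideal_gen G -> x \in ideal_gen H.
Proof. by move=> GH; apply: (ideal_gen_min (is_ideal_gen _)). Qed.

Lemma idealr_exists J : is_ideal J -> ~ J 1 ->
  exists I : idealr A, forall x, x \in I <-> J x.
Proof.
move=> [J0 IJ] J1.
pose S : {pred A} := [pred x | `[< J x >]].
have cS : idealr_closed S.
  split; first by apply/asboolP.
    by apply/negP => /asboolP.
  by move=> c x y /asboolP Jx /asboolP Jy; apply/asboolP; exact: IJ.
pose h := isIdealr.Build A S cS.
pose I : idealr A := HB.pack S h.
by exists I => x; split=> /asboolP.
Qed.

Lemma prime_idealr_exists P : is_prime P ->
  exists I : prime_idealr A, forall x, x \in I <-> P x.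
Proof.
move=> [[P0 IP] P1 PM].
pose S : {pred A} := [pred x | `[< P x >]].
have cS : idealr_closed S.
  split; first by apply/asboolP.
    by apply/negP => /asboolP.
  by move=> c x y /asboolP Jx /asboolP Jy; apply/asboolP; exact: IP.
have pS : prime_idealr_closed S.
  by move=> x y /asboolP /PM [] ?; apply/orP; [left|right]; apply/asboolP.
pose h := isIdealr.Build A S cS.
pose h' := isPrimeIdealrClosed.Build A S pS.
pose I : prime_idealr A := HB.pack S h h'.
by exists I => x; split=> /asboolP.
Qed.

Lemma is_ideal_idealr (I : idealr A) : is_ideal (fun x => x \in I).
Proof.
split=> [|c x y xI yI]; first exact: idealr0.
by rewrite rpredD // idealMr.
Qed.

Lemma is_prime_idealr (I : prime_idealr A) : is_prime (fun x => x \in I).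
Proof.
split; first exact: is_ideal_idealr.
  by rewrite idealr1.
by move=> x y; rewrite prime_idealrM => /orP.
Qed.

Definition is_noetherian := forall J, is_ideal J ->
  exists2 s : seq A, (forall x, x \in s -> J x) &
    forall x, J x -> x \in ideal_gen (fun x => x \in s).

End PropIdeals.

Lemma is_ideal_comap (A B : comNzRingType) (f : {rmorphism A -> B}) J :
  is_ideal J -> is_ideal (fun x => J (f x)).
Proof.
by move=> [J0 IJ]; split=> [|c x y]; rewrite ?rmorph0 // rmorphD rmorphM; exact: IJ.
Qed.

Lemma is_prime_comap (A B : comNzRingType) (f : {rmorphism A -> B}) P :
  is_prime P -> is_prime (fun x => P (f x)).
Proof.
move=> [IP P1 PM]; split; [exact: is_ideal_comap | by rewrite rmorph1 | ].
by move=> x y; rewrite rmorphM; exact: PM.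
Qed.

(** * Algebraic independence modulo a prime *)

Section Independence.
Variables (K : fieldType) (A : comNzRingType) (k : {rmorphism K -> A}).

(** Membership in the K-subalgebra generated by zs, adjoining one generator at a
    time, so that independence can be handled by univariate polynomials. *)
Fixpoint in_subalg (zs : seq A) (a : A) : Prop :=
  if zs is z :: zs' then
    exists2 p : {poly A}, (forall i, in_subalg zs' p`_i) & a = p.[z]
  else exists c, a = k c.

(** Independence modulo P asks for a vanishing polynomial, not only for
    coefficients in P: on K[zs] the two agree, as nonzero elements of K[zs] stay
    nonzero modulo P. *)
Fixpoint indep (P : A -> Prop) (zs : seq A) : Prop :=
  if zs is z :: zs' then
    indep P zs' /\
    (forall p : {poly A}, (forall i, in_subalg zs' p`_i) -> P p.[z] -> p = 0)
  else True.

Lemma indep_subalg P zs a :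
  is_prime P -> indep P zs -> in_subalg zs a -> P a -> a = 0.
Proof.
move=> [IP P1 _]; case: zs => [_ [c ->] Pc | z zs [_ zfree] [p pS ->] Pp].
  have [->|c0] := eqVneq c 0; first by rewrite rmorph0.
  by case: P1; rewrite -(rmorph1 k) -(mulVf c0) rmorphM; exact: ideal_mulr.
by rewrite (zfree p) // horner0.
Qed.

Lemma indep_sub P P' zs :
  (forall x, P x -> P' x) -> indep P' zs -> indep P zs.
Proof.
move=> PP'; elim: zs => [//|z zs IH] [/IH zsP zfree]; split=> // p pS /PP'.
exact: zfree.
Qed.

(** The strict step P < P' is worth one transcendental: if a polynomial relation
    for f over K[zs] held modulo P, its constant term would lie in P' and hence
    vanish, since the zs are independent modulo P'; f is not in P, so it can be
    cancelled, and the degree drops. *)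
Lemma indep_cons_between P P' f zs :
  is_prime P -> is_prime P' -> (forall x, P x -> P' x) -> P' f -> ~ P f ->
  indep P' zs -> indep P (f :: zs).
Proof.
move=> primeP primeP' PP' P'f Pf zsfree; split; first exact: indep_sub PP' zsfree.
have [IP' _ _] := primeP'; have [IP _ PM] := primeP.
elim/poly_ind => [//|p c IHp] pcS Ppc.
have pS i : in_subalg zs p`_i.
  by move: (pcS i.+1); rewrite coefD coefMX coefC addr0.
have cS : in_subalg zs c.
  by move: (pcS 0); rewrite coefD coefMX coefC add0r.
rewrite hornerMXaddC in Ppc.
have c0 : c = 0.
  apply: (indep_subalg primeP' zsfree cS).
  by apply: (ideal_addl IP' _ (PP' _ Ppc)); exact: ideal_mulr.
rewrite {}c0 addr0 in Ppc *; rewrite polyC0 addr0.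
case: (PM _ _ Ppc) => Pp; last by case: Pf.
by rewrite IHp ?mul0r.
Qed.

(** Read from the top of a chain of primes downwards, each step contributes one
    element to an independent sequence; this is what bounds Krull dimension. *)
Lemma indep_chain (c : nat -> A -> Prop) e zs :
  (forall i, (i <= e)%N -> is_prime (c i)) ->
  (forall i, (i < e)%N -> (forall x, c i x -> c i.+1 x) /\
                          exists2 x, c i.+1 x & ~ c i x) ->
  indep (c e) zs -> exists2 ws, indep (c 0) ws & size ws = (e + size zs)%N.
Proof.
elim: e zs => [|e IH] zs pr ch zsP; first by exists zs.
have [sub [f fS fN]] := ch e (leqnn _).
have [|||ws ? sz] := IH (f :: zs) _ _.
- by move=> i le_ie; apply: pr; exact: leqW.
- by move=> i lt_ie; apply: ch; exact: leqW.
- by apply: (indep_cons_between (pr _ _) (pr e.+1 _) sub fS fN zsP).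
by exists ws; rewrite // sz /= addnS.
Qed.

End Independence.

(** * Counting bounds the length of independent sequences *)

Section Counting.
Variable K : fieldType.

(** A multiplicative filtration of A by finite-dimensional pieces of polynomial
    growth of degree n, as given by the degree on a polynomial ring in n
    variables; it is all that the count below needs to know about A. *)
Definition poly_growth (A : comNzRingType) (k : {rmorphism K -> A}) (n : nat) :=
  exists V : nat -> A -> Prop,
  [/\ (forall a, exists i, V i a) /\ (forall i j a, (i <= j)%N -> V i a -> V j a),
      (forall i, V i 0) /\ V 0 1,
      forall i a b, V i a -> V i b -> V i (a + b),
      forall i j a b, V i a -> V j b -> V (i + j)%N (a * b)
    & forall i, exists (T : finType) (b : T -> A), #|T| = (i.+1 ^ n)%N /\
        forall a, V i a -> exists c : T -> K, a = \sum_t k (c t) * b t].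

Lemma free_le_span (A : comNzRingType) (k : {rmorphism K -> A})
    (T U : finType) (u : T -> A) (b : U -> A) :
  (forall c : T -> K, \sum_t k (c t) * u t = 0 -> forall t, c t = 0) ->
  (forall t, exists c : U -> K, u t = \sum_j k (c j) * b j) ->
  (#|T| <= #|U|)%N.
Proof.
move=> ufree /choice[c cE]; rewrite leqNgt; apply/negP => ltUT.
pose M : 'M[K]_(#|T|, #|U|) := \matrix_(i, j) c (enum_val i) (enum_val j).
have /rowV0Pn[v /sub_kermxP vM] : kermx M != 0.
  rewrite -mxrank_eq0 mxrank_ker subn_eq0 -ltnNge.
  exact: leq_ltn_trans (rank_leq_col M) ltUT.
case/eqP; apply/rowP => i; rewrite mxE.
rewrite -(enum_valK i); move: (enum_val i) => {i}; apply: ufree.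
under eq_bigr do rewrite cE mulr_sumr.
rewrite exchange_big big1 //= => j _.
under eq_bigr do rewrite mulrA -rmorphM.
rewrite -mulr_suml -rmorph_sum /=.
have /rowP/(_ (enum_rank j)) := vM; rewrite !mxE => e.
suff -> : \sum_t v 0 (enum_rank t) * c t j = 0 by rewrite rmorph0 mul0r.
rewrite -[RHS]e [RHS](reindex enum_rank) /=; last exact/onW_bij/enum_rank_bij.
by apply: eq_bigr => t _; rewrite mxE !enum_rankK.
Qed.

(** The [D ^ size zs] monomials in zs with exponents below D are linearly
    independent over K and lie in a piece of the filtration whose index is linear
    in D. *)
Lemma indep_monomials (A : comNzRingType) (k : {rmorphism K -> A})
    (V : nat -> A -> Prop) i0 P zs D :
  V 0 1 -> (forall i j a b, V i a -> V j b -> V (i + j)%N (a * b)) ->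
  (forall i j a, (i <= j)%N -> V i a -> V j a) ->
  is_prime P -> indep k P zs -> (forall z, z \in zs -> V i0 z) ->
  exists (T : finType) (u : T -> A),
  [/\ #|T| = (D ^ size zs)%N,
      forall t, V (size zs * (D * i0))%N (u t),
      forall c : T -> K, in_subalg k zs (\sum_t k (c t) * u t)
    & forall c : T -> K, \sum_t k (c t) * u t = 0 -> forall t, c t = 0].
Proof.
move=> V01 VM Vle primeP; elim: zs => [_ _|z zs IH [zsP zfree] zV].
  exists unit, (fun=> 1); split=> [||c|c].
  - by rewrite card_unit expn0.
  - by move=> _; rewrite mul0n.
  - by exists (c tt); rewrite /= (big_pred1 tt) ?mulr1 //; case.
  - rewrite (big_pred1 tt) => [|[] //]; rewrite mulr1 => c0 [].
    exact: (fmorph_inj k) (etrans c0 (esym (rmorph0 k))).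
have [|T [u [cT uV uS ufree]]] := IH zsP.
  by move=> y ys; apply: zV; rewrite inE ys orbT.
have VX d : V (d * i0)%N (z ^+ d).
  elim: d => [|d IHd]; first by rewrite expr0.
  by rewrite exprS mulSn; apply: VM => //; apply: zV; rewrite inE eqxx.
pose pc (c : 'I_D * T -> K) : {poly A} :=
  \poly_(i < D) (if insub i is Some j then \sum_t k (c (j, t)) * u t else 0).
have sumE (c : 'I_D * T -> K) :
    \sum_t k (c t) * (z ^+ t.1 * u t.2) = (pc c).[z].
  rewrite horner_poly.
  transitivity (\sum_(i < D) \sum_t k (c (i, t)) * (z ^+ i * u t)).
    by rewrite pair_bigA; apply: eq_bigr => -[].
  apply: eq_bigr => i _; rewrite valK mulr_suml.
  by apply: eq_bigr => t _; rewrite mulrCA [in RHS]mulrC.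
have coefS (c : 'I_D * T -> K) i : in_subalg k zs (pc c)`_i.
  have z0 : in_subalg k zs 0.
    have := uS (fun=> 0); rewrite big1 // => t _.
    by rewrite rmorph0 mul0r.
  rewrite coef_poly; case: ifP => // iD; case: insubP => [j _ _|//].
  exact: (uS (fun t => c (j, t))).
exists ('I_D * T)%type, (fun t : 'I_D * T => z ^+ t.1 * u t.2); split.
- by rewrite card_prod card_ord cT expnS.
- move=> [i t] /=; rewrite mulSn; apply: VM => //.
  by apply: Vle (VX i); rewrite leq_mul2r (ltnW (ltn_ord i)) orbT.
- move=> c; rewrite sumE.
  by exists (pc c); first exact: coefS.
move=> c; rewrite sumE => e [i t].
have P0 : P 0 by case: primeP => -[].
have /(congr1 (fun p : {poly A} => p`_i)) : pc c = 0.
  by apply: zfree; [exact: coefS | rewrite e].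
by rewrite coef0 coef_poly ltn_ord valK => /(ufree (fun t => c (i, t))).
Qed.

(** With n + 1 independent elements, the number of monomials would grow like
    D^(n+1) inside spaces whose dimension grows like D^n. *)
Lemma indep_size_le (A : comNzRingType) (k : {rmorphism K -> A}) n P zs :
  poly_growth k n -> is_prime P -> indep k P zs -> (size zs <= n)%N.
Proof.
move=> [V [[Vex Vle] [V0 V01] VD VM Vspan]] primeP zsP.
rewrite leqNgt; apply/negP => lt_n.
have {zsP lt_n} [ws wsP sw] : exists2 ws, indep k P ws & size ws = n.+1.
  elim: zs zsP lt_n => [//|z zs IH] /= zsP; rewrite ltnS leq_eqVlt.
  case/orP => [/eqP e|]; first by exists (z :: zs); rewrite //= e.
  by case: zsP => + _; exact: IH.
have [i0 wsV] : exists i0, forall z, z \in ws -> V i0 z.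
  elim: {wsP sw} ws => [|w ws [i IH]]; first by exists 0.
  have [j wj] := Vex w; exists (i + j)%N => z; rewrite inE => /orP[/eqP->|/IH].
    by apply: Vle wj; rewrite leq_addl.
  by apply: Vle; rewrite leq_addr.
(* For this D, the bound ((n + 1) D i0 + 1)^n <= (c D)^n stays below D^(n + 1). *)
pose c := (n.+1 * i0).+1; pose D := (c ^ n).+1.
have [T [u [cT uV _ ufree]]] := indep_monomials D V01 VM Vle primeP wsP wsV.
have [U [b [cU bS]]] := Vspan (size ws * (D * i0))%N.
have := free_le_span ufree (fun t => bS _ (uV t)).
rewrite cT cU sw leqNgt => /negP; apply.
apply: (@leq_ltn_trans ((c * D) ^ n)); last first.
  by rewrite expnMn expnS ltn_pmul2r ?expn_gt0.
have le_exp x y : (x <= y)%N -> (x ^ n <= y ^ n)%N.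
  by case: (n) => // m; rewrite leq_exp2r.
apply: le_exp; rewrite [(c * D)%N]mulSn mulnA mulnAC.
by rewrite -[X in (X <= _)%N]add1n leq_add2r.
Qed.

End Counting.

(** * Prime ideals of a polynomial ring and the basis theorem *)

Section PolyIdeals.
Variable A : comNzRingType.
Implicit Types (J P Q : A -> Prop).

Definition poly_ext P (p : {poly A}) : Prop := forall i, P p`_i.

Lemma ideal_polyC_coef (J : {poly A} -> Prop) (p : {poly A}) :
  is_ideal J -> (forall i, J (p`_i)%:P) -> J p.
Proof.
move=> IJ Jp; rewrite -[p]coefK poly_def; apply: ideal_sum => // i.
by rewrite -mul_polyC mulrC; exact: ideal_mulr.
Qed.

Lemma is_ideal_poly_ext P : is_ideal P -> is_ideal (poly_ext P).
Proof.
move=> IP; have [P0 _] := IP; split=> [i|c x y xP yP i]; first by rewrite coef0.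
rewrite coefD; apply: ideal_add_closed => //; rewrite coefM.
by apply: ideal_sum => // j; exact: ideal_mulr.
Qed.

Lemma poly_ext_minP P (p : {poly A}) : ~ poly_ext P p ->
  exists2 i, ~ P p`_i & forall j, (j < i)%N -> P p`_j.
Proof.
move=> /existsNP[i Pi].
have ex : exists i, ~~ `[< P p`_i >] by exists i; apply/asboolPn.
case: (ex_minnP ex) => j /asboolPn Pj jmin; exists j => // l lt_lj.
apply: contrapT => /asboolPn/jmin; rewrite leqNgt lt_lj.
by [].
Qed.

(** The usual product of the first coefficients outside P. *)
Lemma is_prime_poly_ext P : is_prime P -> is_prime (poly_ext P).
Proof.
move=> [IP P1 PM]; split; first exact: is_ideal_poly_ext.
  by move/(_ 0); rewrite coefC.
move=> p q pqP; apply: contrapT => /not_orP[pP qP].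
have [i Pi ltP] := poly_ext_minP pP; have [j Qj ltQ] := poly_ext_minP qP.
have := pqP (i + j)%N; rewrite coefM.
have lti : (i < (i + j).+1)%N by rewrite ltnS leq_addr.
rewrite (bigD1 (Ordinal lti)) //= addKn addrC => Psum.
suff /ideal_addl/(_ Psum)/PM[] :
  P (\sum_(l < (i + j).+1 | l != Ordinal lti) p`_l * q`_(i + j - l)) by [].
elim/big_rec: _ => [|l x neq_l Px]; first by case: IP.
apply: ideal_add_closed => //.
have [/ltP ltl|gtl|eql] := ltngtP l i.
- by rewrite mulrC; apply: ideal_mulr => //; apply: ltP.
- apply: ideal_mulr => //; apply: ltQ.
  by rewrite ltn_subLR ?ltn_add2r // -ltnS.
- by case/eqP: neq_l; apply: val_inj.
Qed.

(** Hilbert's basis theorem. The coefficients of degree k of the members of J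
    of degree at most k form an increasing sequence of ideals [L k], stationary
    from some d on; lifts to J of finitely many generators of [L k] for k <= d
    generate J, by induction on the degree. *)
Lemma noetherian_poly : is_noetherian A -> is_noetherian {poly A}.
Proof.
move=> noethA J IJ.
pose L k a := exists p, [/\ J p, (size p <= k.+1)%N & a = p`_k].
have IL k : is_ideal (L k).
  split; first by exists 0; rewrite coef0 size_poly0; case: IJ.
  move=> c _ _ [p [Jp sp ->]] [q [Jq sq ->]].
  exists (c%:P * p + q); split; first by case: IJ => _; exact.
    rewrite (leq_trans (size_polyD _ _)) // geq_max sq andbT mul_polyC.
    exact: leq_trans (size_scale_leq _ _) sp.
  by rewrite coefD coefCM.
have Lle k l a : (k <= l)%N -> L k a -> L l a.
  move=> le_kl [p [Jp sp ->]]; exists ('X^(l - k) * p); split.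
  - exact: ideal_mulr.
  - rewrite (leq_trans (size_polyMleq _ _)) // size_polyXn addSn /=.
    by rewrite -[X in (_ <= X.+1)%N](subnK le_kl) -addnS leq_add2l.
  - by rewrite coefXnM ltnNge leq_subr subKn.
have Linf : is_ideal (fun a => exists k, L k a).
  split; first by exists 0; case: (IL 0).
  move=> c x y [i Lx] [j Ly]; exists (i + j)%N; case: (IL (i + j)%N) => _; apply.
    by apply: Lle Lx; rewrite leq_addr.
  by apply: Lle Ly; rewrite leq_addl.
have [d dP] : exists d, forall k a, L k a -> L d a.
  have [s sL sgen] := noethA _ Linf.
  have [d sd] : exists d, forall x, x \in s -> L d x.
    elim: s sL {sgen} => [|x s IH] sL; first by exists 0.
    have [|i si] := IH; first by move=> y ys; apply: sL; rewrite inE ys orbT.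
    have [j xj] := sL x (mem_head _ _).
    exists (i + j)%N => y; rewrite inE => /orP[/eqP->|/si].
      by apply: Lle xj; rewrite leq_addl.
    by apply: Lle; rewrite leq_addr.
  exists d => k a Lka; apply: (ideal_gen_min (IL d) sd).
  by apply: sgen; exists k.
have /choice[G GP] : forall k, exists G : seq {poly A}, (forall g, g \in G -> J g) /\
    forall a, L k a -> exists h, [/\ h \in ideal_gen (fun x => x \in G),
                                     (size h <= k.+1)%N & h`_k = a].
  move=> k; have [s sL sgen] := noethA _ (IL k).
  have /choice[f fP] : forall x, exists p : {poly A}, x \in s ->
      [/\ J p, (size p <= k.+1)%N & x = p`_k].
    move=> x; have [xs|/negP xs] := boolP (x \in s); last by exists 0.
    by have [p] := sL _ xs; exists p.
  exists (map f s); split=> [g /mapP[x /fP[Jx _ _] ->] //|a /sgen].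
  case/ideal_genP => e [b [g [gs ->]]].
  exists (\sum_i (b i)%:P * f (g i)); split.
  - apply: (ideal_sum (is_ideal_gen _)) => i.
    apply: (ideal_mulr _ (is_ideal_gen _)).
    by apply: mem_ideal_gen; apply: map_f.
  - apply: leq_trans (size_sum _ _ _) _; apply/bigmax_leqP => i _.
    rewrite mul_polyC; apply: leq_trans (size_scale_leq _ _) _.
    by have [] := fP _ (gs i).
  - rewrite coef_sum; apply: eq_bigr => i _; rewrite coefCM.
    by have [_ _ <-] := fP _ (gs i).
pose S := flatten [seq G i | i <- iota 0 d.+1].
have sGS k x : (k <= d)%N -> x \in ideal_gen (fun x => x \in G k) ->
    x \in ideal_gen (fun x => x \in S).
  move=> le_kd; apply: ideal_gen_sub => g gG; apply: mem_ideal_gen.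
  by apply/flatten_mapP; exists k; rewrite // mem_iota.
have SJ x : x \in S -> J x.
  by case/flatten_mapP => i _; case: (GP i) => + _; exact.
exists S => // p; have [n] := ubnP (size p); elim: n p => [//|n IH] p lt_n Jp.
have [sp0|sp0] := posnP (size p).
  by move/eqP: sp0; rewrite size_poly_eq0 => /eqP ->; exact: ideal_gen0.
pose k := (size p).-1; have sp : size p = k.+1 by rewrite prednK.
have Lp : L k p`_k by exists p; rewrite sp.
have [h [hS sh hk]] : exists h, [/\ h \in ideal_gen (fun x => x \in S),
    (size h <= k.+1)%N & h`_k = p`_k].
  have [le_kd|/ltnW le_dk] := leqP k d.
    have [h [hG sh hk]] := (GP k).2 _ Lp.
    by exists h; split=> //; exact: sGS hG.
  have [h [hG sh hk]] := (GP d).2 _ (dP _ _ Lp).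
  exists ('X^(k - d) * h); split.
  - by apply: (ideal_mulr _ (is_ideal_gen _)); exact: sGS hG.
  - rewrite (leq_trans (size_polyMleq _ _)) // size_polyXn addSn /=.
    by rewrite -[X in (_ <= X.+1)%N](subnK le_dk) -addnS leq_add2l.
  - by rewrite coefXnM ltnNge leq_subr subKn.
rewrite -[p](subrK h); apply: (ideal_add_closed (is_ideal_gen _)) => //.
apply: IH; last by apply: ideal_sub => //; exact: ideal_gen_min hS.
apply: leq_trans (_ : k.+1 <= n)%N; last by rewrite -sp -ltnS.
rewrite ltnS; apply/leq_sizeP => j; rewrite leq_eqVlt => /orP[/eqP <-|lt_kj].
  by rewrite coefB hk subrr.
by rewrite coefB !nth_default ?subrr // (leq_trans _ lt_kj) // sp.
Qed.

End PolyIdeals.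

Lemma noetherian_field (K : fieldType) : is_noetherian K.
Proof.
move=> J IJ; have [J0|] := pselect (forall x, J x -> x = 0); last first.
  case/existsNP => x /not_implyP[Jx /eqP x0].
  exists [:: x] => [y|y _]; first by rewrite inE => /eqP ->.
  rewrite -[y](divfK x0); apply: (ideal_mulr _ (is_ideal_gen _)).
  by apply: mem_ideal_gen; rewrite mem_head.
by exists [::] => [//|x /J0 ->]; exact: ideal_gen0.
Qed.

(** * Growth of polynomial rings *)

Section Growth.
Variable K : fieldType.

Lemma poly_growth_field : poly_growth (idfun : {rmorphism K -> K}) 0.
Proof.
exists (fun _ _ => True); split=> //; first by split=> // a; exists 0.
move=> i; exists unit, (fun=> 1); split=> [|a _]; first by rewrite card_unit.
by exists (fun=> a); rewrite (big_pred1 tt) ?mulr1 //; case.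
Qed.

Lemma poly_growth_poly (A : comNzRingType) (k : {rmorphism K -> A}) n :
  poly_growth k n -> poly_growth (polyC \o k : {rmorphism K -> {poly A}}) n.+1.
Proof.
move=> [V [[Vex Vle] [V0 V01] VD VM Vspan]].
have Vsum i (I : finType) (F : I -> A) :
    (forall j, V i (F j)) -> V i (\sum_j F j).
  move=> VF; elim/big_rec: _ => [|j x _ Vx]; [exact: V0 | exact: VD].
exists (fun i (p : {poly A}) => (size p <= i.+1)%N /\ forall j, V i p`_j); split.
- split=> [p|i j p le_ij [sp pV]]; last first.
    split=> [|l]; first exact: leq_trans sp _.
    exact: Vle (pV l).
  have [i iP] : exists i, forall j, V i p`_j.
    have /choice[f fP] := fun j => Vex p`_j.
    exists (\max_(j < size p) f j) => j.
    have [lt_j|/(nth_default 0)->] := ltnP j (size p); last exact: V0.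
    exact: Vle (leq_bigmax (Ordinal lt_j)) (fP j).
  exists (size p + i)%N; split; first by rewrite (leq_trans (leq_addr i _)).
  by move=> j; apply: Vle (iP j); rewrite leq_addl.
- split=> [i|]; first by rewrite size_poly0; split=> // j; rewrite coef0.
  rewrite size_poly1; split=> // j; rewrite coefC.
  by case: ifP.
- move=> i p q [sp pV] [sq qV]; split=> [|j]; last by rewrite coefD; exact: VD.
  by rewrite (leq_trans (size_polyD _ _)) // geq_max sp.
- move=> i j p q [sp pV] [sq qV]; split=> [|l].
    rewrite (leq_trans (size_polyMleq _ _)) // -subn1 leq_subLR add1n.
    by rewrite (leq_trans (leq_add sp sq)) // addSn addnS.
  by rewrite coefM; apply: Vsum => a; exact: VM.
move=> i; have [T [b [cT bP]]] := Vspan i.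
exists ('I_i.+1 * T)%type, (fun t : 'I_i.+1 * T => 'X^(val t.1) * (b t.2)%:P).
split=> [|p [sp pV]]; first by rewrite card_prod card_ord cT expnS.
have /choice[c cP] : forall j, exists c : T -> K, p`_j = \sum_t k (c t) * b t.
  by move=> j; exact: bP.
exists (fun t : 'I_i.+1 * T => c (val t.1) t.2).
transitivity (\sum_(j < i.+1) \sum_t (polyC \o k) (c j t) * ('X^j * (b t)%:P)).
  have {1}-> : p = \poly_(j < i.+1) p`_j.
    apply/polyP => j; rewrite coef_poly; case: ltnP => // ge_j.
    by rewrite nth_default // (leq_trans sp).
  rewrite poly_def.
  apply: eq_bigr => j _.
  rewrite cP -mul_polyC rmorph_sum mulr_suml; apply: eq_bigr => t _.
  by rewrite /= polyCM; ring.
by rewrite pair_bigA; apply: eq_bigr => -[].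
Qed.

End Growth.

(** * Local generators and chains, one variable at a time *)

Section Regular.
Variable K : fieldType.

Definition chain_to (A : comNzRingType) (c : nat -> A -> Prop) d (Q : A -> Prop) :=
  [/\ forall i, (i <= d)%N -> is_prime (c i),
      forall i, (i < d)%N -> (forall x, c i x -> c i.+1 x) /\
                             exists2 x, c i.+1 x & ~ c i x
    & forall x, c d x <-> Q x].

(** The elements of g generate the maximal ideal of the localization at Q. *)
Definition locally_generates (A : comNzRingType) (g : seq A) (Q : A -> Prop) :=
  (forall x, x \in g -> Q x) /\
  forall h, Q h -> exists2 s, ~ Q s & s * h \in ideal_gen (fun x => x \in g).

(** At every prime Q, one number [size g] is at once the length of a chain of
    primes ending at Q, a number of generators of Q after localization, and the
    codimension n - trdeg. The first bounds the dimension of the local ring from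
    below, the last from above through [indep_chain] and [indep_size_le]. *)
Definition regular_dim (A : comNzRingType) (k : {rmorphism K -> A}) n :=
  forall Q, is_prime Q -> exists (c : nat -> A -> Prop) (g zs : seq A),
    [/\ chain_to c (size g) Q, locally_generates g Q,
        indep k Q zs & (size zs + size g)%N = n].

Lemma regular_dim_field : regular_dim (idfun : {rmorphism K -> K}) 0.
Proof.
move=> Q [IQ Q1 QM]; exists (fun=> Q), [::], [::]; split=> //.
split=> // h Qh; exists 1 => //.
have [->|h0] := eqVneq h 0; first by rewrite mulr0 ideal_gen0.
by case: Q1; rewrite -(mulVf h0); exact: ideal_mulr.
Qed.

Lemma map_polyC_lift (A : comNzRingType) (S : A -> Prop) (p : {poly {poly A}}) :
  (forall i, exists2 a, S a & p`_i = a%:P) ->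
  exists2 q : {poly A}, (forall i, S q`_i) & p = map_poly polyC q.
Proof.
move=> pS.
have qE i : (\poly_(j < size p) (p`_j)`_0)`_i = (p`_i)`_0.
  rewrite coef_poly; case: ltnP => // /(nth_default 0) ->.
  by rewrite coef0.
exists (\poly_(j < size p) (p`_j)`_0) => [i|].
  by rewrite qE; have [a aS ->] := pS i; rewrite coefC.
apply/polyP => i; rewrite coef_map qE.
by have [a aS ->] := pS i; rewrite coefC.
Qed.

Lemma in_subalg_polyC (A : comNzRingType) (k : {rmorphism K -> A}) zs b :
  in_subalg (polyC \o k : {rmorphism K -> {poly A}}) (map polyC zs) b ->
  exists2 a, in_subalg k zs a & b = a%:P.
Proof.
elim: zs b => [b [c ->]|z zs IH b [p pS ->]]; first by exists (k c) => //; exists c.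
have [q qS ->] := map_polyC_lift (fun i => IH _ (pS i)).
by exists q.[z]; [exists q | rewrite horner_map].
Qed.

Lemma poly_subalg_polyC (A : comNzRingType) (k : {rmorphism K -> A}) zs
    (p : {poly {poly A}}) :
  (forall i, in_subalg (polyC \o k : {rmorphism K -> {poly A}}) (map polyC zs) p`_i) ->
  exists2 q : {poly A}, (forall i, in_subalg k zs q`_i) & p = map_poly polyC q.
Proof. by move=> pS; apply: map_polyC_lift => i; exact: in_subalg_polyC. Qed.

Lemma indep_polyC (A : comNzRingType) (k : {rmorphism K -> A}) zs
    (Q : {poly A} -> Prop) :
  indep k (fun a => Q a%:P) zs ->
  indep (polyC \o k : {rmorphism K -> {poly A}}) Q (map polyC zs).
Proof.
elim: zs => [//|z zs IH] [/IH zsQ zfree]; split=> // _ /poly_subalg_polyC[p pS ->].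
by rewrite horner_map => /(zfree _ pS) ->; rewrite rmorph0.
Qed.

Lemma indep_polyX (A : comNzRingType) (k : {rmorphism K -> A}) zs
    (P : A -> Prop) : is_prime P ->
  indep k P zs ->
  indep (polyC \o k : {rmorphism K -> {poly A}}) (poly_ext P) ('X :: map polyC zs).
Proof.
move=> primeP zsP; split.
  apply: indep_polyC; elim: zs zsP => [//|z zs IH] [/IH zsP zfree]; split=> // p pS.
  by move/(_ 0); rewrite coefC; exact: zfree.
move=> _ /poly_subalg_polyC[p pS ->].
rewrite -[_.['X]]/(p \Po 'X) comp_polyXr => pP.
suff -> : p = 0 by rewrite rmorph0.
apply/polyP => i; rewrite coef0.
exact: (indep_subalg primeP zsP (pS i) (pP i)).
Qed.

(** In this section q stands for the contraction of the prime Q of A[X] to A. *)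
Section Step.
Variables (A : comNzRingType) (Q : {poly A} -> Prop).
Hypothesis primeQ : is_prime Q.
Local Notation q := (fun a => Q a%:P).

Lemma contract_prime : is_prime q.
Proof. exact: (is_prime_comap (polyC : {rmorphism A -> {poly A}}) primeQ). Qed.

Lemma poly_ext_contract p : poly_ext q p -> Q p.
Proof. by have [IQ _ _] := primeQ; exact: ideal_polyC_coef. Qed.

Lemma poly_ext_lift_gens g p : locally_generates g q -> poly_ext q p ->
  exists2 s, ~ q s & s%:P * p \in ideal_gen (fun x => x \in map polyC g).
Proof.
move=> [_ gq] pq; have [Iq q1 qM] := contract_prime.
have /choice[s sP] i : exists s, ~ q s /\ s * p`_i \in ideal_gen (fun x => x \in g).
  by have [s] := gq _ (pq i); exists s.
exists (\prod_(i < size p) s i).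
  elim/big_rec: _ => [|i x _ qx]; first exact: q1.
  by case/qM; first by have [] := sP i.
have II := @is_ideal_gen _ (fun x => x \in map polyC g).
apply: (ideal_polyC_coef II) => i; rewrite coefCM.
have [lt_i|/(nth_default 0) ->] := ltnP i (size p); last by rewrite mulr0; case: II.
rewrite (bigD1 (Ordinal lt_i)) //= mulrAC mulrC polyCM; apply: (ideal_mulr _ II).
apply: (@ideal_gen_min _ (fun a => a%:P \in _) _ _ _ _ (sP i).2).
  exact: (is_ideal_comap (polyC : {rmorphism A -> {poly A}}) II).
by move=> x xg; apply: mem_ideal_gen; apply: map_f.
Qed.

(** Removing leading terms with coefficient in q changes neither hypothesis. *)
Lemma poly_strip (p : {poly A}) : Q p -> ~ poly_ext q p ->
  exists f, [/\ Q f, ~ q (lead_coef f) & (size f <= size p)%N].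
Proof.
have [IQ _ _] := primeQ; have [Iq _ _] := contract_prime.
have [n] := ubnP (size p); elim: n p => [//|n IH] p lt_n Qp pq.
have [ql|] := pselect (q (lead_coef p)); last by exists p.
have p0 : p != 0.
  by apply/eqP => e; apply: pq; rewrite e => i; rewrite coef0; case: Iq.
pose t := (lead_coef p)%:P * 'X^((size p).-1).
have Qt : Q t by rewrite /t mulrC; exact: ideal_mulr.
have lt_t : (size (p - t)%R < size p)%N.
  rewrite -[X in (_ < X)%N](prednK (n := size p)) ?lt0n ?size_poly_eq0 // ltnS.
  apply/leq_sizeP => j; rewrite coefB coefCM coefXn leq_eqVlt.
  case/orP => [/eqP <-|lt_j]; first by rewrite eqxx mulr1 subrr.
  rewrite gtn_eqF // mulr0 subr0 nth_default //.
  by move: lt_j; case: (size p).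
have [|||f [Qf fq le_f]] := IH (p - t).
- exact: leq_trans lt_t _.
- exact: ideal_sub.
- move=> h; apply: pq => i; rewrite -[p](subrK t) coefD.
  apply: (ideal_add_closed Iq) => //; rewrite coefCM mulrC.
  exact: (ideal_mulr _ Iq).
by exists f; split=> //; apply: leq_trans le_f (ltnW lt_t).
Qed.

(** Over the residue field of q, polynomials in one variable form a principal
    ideal domain, so Q is generated by q and one more element f. Concretely, f has
    least degree among the members of Q with leading coefficient outside q, and
    pseudo-division by f leads to a remainder with coefficients in q. *)
Lemma locally_generates_cons g : locally_generates g q ->
  (exists2 p, Q p & ~ poly_ext q p) ->
  exists f, locally_generates (f :: map polyC g) Q.
Proof.
move=> gq [p Qp pq]; have [IQ Q1 QM] := primeQ.
have [f0 [Qf0 f0q _]] := poly_strip Qp pq.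
have ex : exists n, `[< exists2 f, Q f /\ ~ q (lead_coef f) & size f = n >].
  by exists (size f0); apply/asboolP; exists f0.
case: (ex_minnP ex) => n /asboolP[f [Qf fq] sf] nmin {p Qp pq f0 Qf0 f0q ex}.
have small p : Q p -> (size p < size f)%N -> poly_ext q p.
  move=> Qp; rewrite ltnNge sf => /negP lt_p; apply: contrapT => /(poly_strip Qp).
  case=> h [Qh hq le_h]; apply: lt_p; apply: leq_trans le_h.
  by apply: nmin; apply/asboolP; exists h.
exists f; split.
  move=> x; rewrite inE => /orP[/eqP -> //|/mapP[y yg ->]].
  by case: gq => + _; exact.
move=> h; have [N] := ubnP (size h); elim: N h => [//|N IH] h lt_N Qh.
pose I := fun x => x \in ideal_gen (fun x => x \in f :: map polyC g).
have II : is_ideal I by exact: is_ideal_gen.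
have [lt_hf|le_fh] := ltnP (size h) (size f).
  have [s sq sh] := poly_ext_lift_gens gq (small _ Qh lt_hf).
  exists s%:P => //; apply: ideal_gen_sub sh => x xg.
  by apply: mem_ideal_gen; rewrite inE xg orbT.
(* One step of pseudo-division cancels the leading term of lc(f) h. *)
pose m := (size h - size f)%N.
pose t := (lead_coef h)%:P * 'X^m * f.
have f0 : f != 0.
  by apply/eqP => e; apply: fq; rewrite e lead_coef0; case: IQ.
have sf0 : (0 < size f)%N by rewrite lt0n size_poly_eq0.
have [||s sQ sI] := IH ((lead_coef f)%:P * h - t).
- apply: leq_trans (_ : size h <= N)%N; last by [].
  have sh0 : (0 < size h)%N by apply: leq_trans le_fh.
  rewrite -(prednK sh0) ltnS; apply/leq_sizeP => j lej.
  rewrite coefB coefCM /t -mulrA coefCM coefXnM.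
  have -> : (j < m)%N = false.
    apply/negbTE; rewrite -leqNgt (leq_trans _ lej) // /m.
    by rewrite -(prednK sf0) -(prednK sh0) subSS leq_subr.
  move: lej; rewrite leq_eqVlt => /orP[/eqP <-|lt_j].
    have -> : ((size h).-1 - m)%N = (size f).-1.
      by rewrite /m -(prednK sf0) -{1 2}(prednK sh0) subSS /= subKn // -ltnS !prednK.
    by rewrite -!lead_coefE mulrC subrr.
  rewrite !(nth_default 0) ?mulr0 ?subrr //.
    have sfm : (size f + m)%N = size h by rewrite /m subnKC.
    have le_hj : (size h <= j)%N by move: lt_j; rewrite prednK.
    by rewrite -(leq_add2r m) subnK ?sfm // (leq_trans _ le_hj) // leq_subr.
  by move: lt_j; rewrite prednK.
- apply: ideal_sub => //; exact: ideal_mulr.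
exists (s * (lead_coef f)%:P); first by case/QM.
rewrite -mulrA -[_ * h](subrK t) mulrDr.
apply: (ideal_add_closed II) => //; apply: (ideal_mulr _ II).
apply: (ideal_mulr _ II); apply: mem_ideal_gen; exact: mem_head.
Qed.

End Step.

(** Either Q = q[X], and then the variable is one more element independent modulo
    Q; or Q is strictly larger than q[X], and then both the chain and the list of
    generators grow by one. *)
Lemma regular_dim_poly (A : comNzRingType) (k : {rmorphism K -> A}) n :
  regular_dim k n -> regular_dim (polyC \o k : {rmorphism K -> {poly A}}) n.+1.
Proof.
move=> regA Q primeQ; pose q a := Q a%:P.
have primeq : is_prime q := contract_prime primeQ.
have [c [g [zs [[cpr cincr cq] gq zsq szs]]]] := regA q primeq.
have ext_incr i : (i < size g)%N ->
    (forall p, poly_ext (c i) p -> poly_ext (c i.+1) p) /\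
    exists2 p, poly_ext (c i.+1) p & ~ poly_ext (c i) p.
  move=> lt_i; have [sub [x x1 x0]] := cincr i lt_i; split=> [p pc j|].
    exact: sub.
  exists x%:P => [j|]; last by move/(_ 0); rewrite coefC.
  by rewrite coefC; case: ifP => // _; case: (cpr i.+1 lt_i) => -[].
have ext_q p : poly_ext (c (size g)) p <-> poly_ext q p.
  by split=> pc i; apply/cq.
have [Qext|/existsNP[p /not_implyP[Qp pq]]] :=
    pselect (forall p, Q p -> poly_ext q p).
  have Qq p : poly_ext q p <-> Q p.
    by split; [exact: poly_ext_contract | exact: Qext].
  exists (fun i => poly_ext (c i)), (map polyC g), ('X :: map polyC zs).
  split; rewrite /= ?size_map //.
  - split=> [i /cpr /is_prime_poly_ext // | // | p].
    by rewrite ext_q.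
  - split=> [_ /mapP[x xg ->]|h /Qext/(poly_ext_lift_gens primeQ gq)[s sq sh]].
      by case: gq => + _; exact.
    by exists s%:P.
  - have [_ Xfree] := indep_polyX primeq zsq; split; first exact: indep_polyC.
    by move=> p pS /Qq; exact: Xfree.
  - by rewrite addSn szs.
have [f fQ] := locally_generates_cons primeQ gq (ex_intro2 _ _ p Qp pq).
exists (fun i => if (i <= size g)%N then poly_ext (c i) else Q).
exists (f :: map polyC g), (map polyC zs).
split; rewrite //= ?size_map ?addnS ?szs //; last exact: indep_polyC.
split.
- by move=> i _; case: leqP => // /cpr; exact: is_prime_poly_ext.
- move=> i; rewrite ltnS => le_i; rewrite le_i.
  case: ltnP => [/ext_incr //|ge_i].
  have {ge_i le_i} -> : i = size g by apply/eqP; rewrite eqn_leq le_i.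
  split=> [x /ext_q|]; first exact: poly_ext_contract.
  by exists p => // /ext_q.
- by move=> x; rewrite ltnn.
Qed.

End Regular.

(** * Localizations that are regular *)

(** A characterization up to isomorphism of the localization at Q of a domain T,
    whence the injectivity. *)
Record is_localization (T L : comNzRingType) (phi : {rmorphism T -> L})
    (Q : T -> Prop) : Prop := IsLocalization {
  loc_unit : forall b, ~ Q b -> exists c, phi b * c = 1;
  loc_frac : forall z, exists a b, ~ Q b /\ z * phi b = phi a;
  loc_nonunit : forall a c, Q a -> phi a * c <> 1;
  loc_inj : forall a, phi a = 0 -> a = 0
}.

Section RegularLocalization.
Variables (T L : comNzRingType) (phi : {rmorphism T -> L}) (Q : T -> Prop).
Hypotheses (primeQ : is_prime Q) (locL : is_localization phi Q).

Let IQ : is_ideal Q. Proof. by case: primeQ. Qed.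
Let Q1 : ~ Q 1. Proof. by case: primeQ. Qed.
Let QM x y : ~ Q x -> ~ Q y -> ~ Q (x * y).
Proof. by case: primeQ => _ _ PM Qx Qy /PM[]. Qed.

(** The extension to L of an ideal P of T. *)
Definition loc_ext (P : T -> Prop) (z : L) : Prop :=
  exists a b, [/\ P a, ~ Q b & z * phi b = phi a].

Lemma loc_inj2 a b : phi a = phi b -> a = b.
Proof.
by move=> e; apply/subr0_eq/(loc_inj locL); rewrite rmorphB /= e subrr.
Qed.

Lemma loc_ext_phi P a : is_prime P -> (forall x, P x -> Q x) ->
  loc_ext P (phi a) -> P a.
Proof.
move=> [IP _ PM] PQ [a' [b [Pa' Qb]]].
rewrite -rmorphM => /loc_inj2 e; rewrite -e in Pa'.
by case: (PM _ _ Pa') => // /PQ.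
Qed.

Lemma loc_ext_in P a : P a -> loc_ext P (phi a).
Proof. by exists a, 1; split; rewrite // rmorph1 mulr1. Qed.

Lemma loc_ext_prime P : is_prime P -> (forall x, P x -> Q x) ->
  is_prime (loc_ext P).
Proof.
move=> primeP PQ; have [IP P1 PM] := primeP; split.
- split; first by rewrite -(rmorph0 phi); apply: loc_ext_in; case: IP.
  move=> w x y [a [b [Pa Qb xE]]] [a' [b' [Pa' Qb' yE]]].
  have [c [d [Qd wE]]] := loc_frac locL w.
  exists (c * b' * a + d * b * a'), (d * b * b'); split.
  - by apply: ideal_add_closed => //; exact: ideal_mulr.
  - by apply: QM => //; exact: QM.
  - by rewrite rmorphD !rmorphM /= -xE -yE -wE; ring.
- by rewrite -(rmorph1 phi) => /loc_ext_phi; exact: (fun h => P1 (h primeP PQ)).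
move=> z w [a [b [Pa Qb zwE]]].
have [c [d [Qd zE]]] := loc_frac locL z.
have [c' [d' [Qd' wE]]] := loc_frac locL w.
have e : c * c' * b = a * d * d'.
  by apply: loc_inj2; rewrite !rmorphM /= -zwE -zE -wE; ring.
have: P (c * c' * b) by rewrite e -mulrA mulrC; exact: ideal_mulr.
case/PM => [/PM[Pc|Pc']|/PQ //].
- by left; exists c, d.
- by right; exists c', d'.
Qed.

Lemma loc_max_unit z : ~ loc_ext Q z -> exists c, z * c = 1.
Proof.
have [a [b [Qb zE]]] := loc_frac locL z => Qz.
have [|c ac] := loc_unit locL (b := a); first by move=> Qa; apply: Qz; exists a, b.
by exists (phi b * c); rewrite mulrA zE.
Qed.

Lemma loc_max_proper (J : idealr L) z : z \in J -> loc_ext Q z.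
Proof.
move=> zJ; apply: contrapT => /loc_max_unit[c zc].
by have := idealMr c zJ; rewrite mulrC zc idealr1.
Qed.

Lemma noetherian_localization : is_noetherian T -> noetherian L.
Proof.
move=> noethT J; have IJ := is_ideal_idealr J.
have [s sJ sgen] := noethT _ (is_ideal_comap phi IJ).
exists (map phi s) => z; apply/idP/idP => [zJ|]; last first.
  by apply: (ideal_gen_min IJ) => _ /mapP[x /sJ xJ ->].
have [a [b [Qb zE]]] := loc_frac locL z.
have [c bc] := loc_unit locL Qb.
have {}bc : z = c * phi a by rewrite -zE mulrC -mulrA bc mulr1.
rewrite bc; apply: (ideal_mulr _ (is_ideal_gen _)).
have aJ : phi a \in J by rewrite -zE mulrC idealMr.
apply: (ideal_gen_min (is_ideal_comap phi (is_ideal_gen _)) _ (sgen a aJ)).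
by move=> x xs; apply: mem_ideal_gen; exact: map_f.
Qed.

Variables (K : fieldType) (k : {rmorphism K -> T}) (n : nat).

(** The chain and the generators given by [regular_dim] extend to L, and any chain
    of primes of L contracts to a chain of primes contained in Q, whose length is
    limited by the size of an independent sequence. *)
Theorem regular_local_localization :
  is_noetherian T -> poly_growth k n -> regular_dim k n -> regular_local_ring L.
Proof.
move=> noethT growT regT; split; first exact: noetherian_localization.
have [c [g [zs [[cpr cincr cQ] [gQ gen] zsQ szs]]]] := regT _ primeQ.
have [I0 I1 _] := loc_ext_prime primeQ (fun _ => id).
have [M MP] := idealr_exists I0 I1.
have cmono i j : (i <= j)%N -> (j <= size g)%N -> forall x, c i x -> c j x.
  elim: j => [|j IH]; first by rewrite leqn0 => /eqP ->.
  rewrite leq_eqVlt => /orP[/eqP <- //|le_ij] lt_j x /(IH le_ij (ltnW lt_j)).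
  exact: (proj1 (cincr _ lt_j)).
have cle i : (i <= size g)%N -> forall x, c i x -> Q x.
  by move=> le_i x /(cmono _ _ le_i (leqnn _)) /cQ.
exists M; split.
  have Mmax (N : idealr L) : {subset N <= M} by move=> z /loc_max_proper/MP.
  split=> [J MJ z|N Nmax z]; first by apply/idP/idP => [/Mmax|/MJ].
  by rewrite (Nmax M (Mmax N)).
exists (size (map phi g)); split; last first.
  exists (in_tuple (map phi g)) => z; apply/idP/idP; last first.
    move=> zg; apply/MP; apply: (ideal_gen_min I0) zg => _ /mapP[x /gQ Qx ->].
    exact: loc_ext_in.
  case/MP => a [b [Qa Qb zE]].
  have [s Qs sa] := gen _ Qa.
  have [d bd] := loc_unit locL Qb; have [t st] := loc_unit locL Qs.
  have -> : z = (d * t) * phi (s * a).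
    by rewrite rmorphM /= -zE -[LHS]mulr1 -[LHS]mulr1 -{1}st -bd; ring.
  apply: (ideal_mulr _ (is_ideal_gen _)).
  apply: (ideal_gen_min (is_ideal_comap phi (is_ideal_gen _)) _ sa).
  by move=> x xs; apply: mem_ideal_gen; exact: map_f.
rewrite size_map; split.
  have /choice[C CP] : forall i : 'I_(size g).+1, exists I : prime_idealr L,
      forall z, z \in I <-> loc_ext (c i) z.
    move=> i; apply: prime_idealr_exists; apply: loc_ext_prime.
      by apply: cpr; rewrite -ltnS.
    by apply: cle; rewrite -ltnS.
  exists C => i j lt_ij.
  have le_j : (j <= size g)%N by rewrite -ltnS.
  split=> [z /CP[a [b [ca Qb zE]]]|].
    by apply/CP; exists a, b; split=> //; exact: cmono (ltnW lt_ij) le_j _ ca.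
  have [_ [x cx cNx]] := cincr i (leq_trans lt_ij le_j).
  exists (phi x); first by apply/CP; apply: loc_ext_in; exact: cmono lt_ij le_j _ cx.
  apply/negP => /CP /loc_ext_phi h; apply: cNx; apply: h.
    by apply: cpr; rewrite -ltnS.
  by apply: cle; rewrite -ltnS.
move=> e C Cchain.
pose p (i : nat) x := phi x \in C (inord i).
have ppr i : is_prime (p i) := is_prime_comap phi (is_prime_idealr (C (inord i))).
have pQ i x : p i x -> Q x.
  move=> px; apply: contrapT => /(loc_unit locL)[d xd].
  by have := idealMr d px; rewrite mulrC xd idealr1.
have [|ws wsP sws] :=
  indep_chain (c := p) (e := e) (fun i _ => ppr i) _ (indep_sub (pQ e) zsQ).
  move=> i lt_ie; have [|sub [z z1 z0]] := Cchain (inord i) (inord i.+1).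
    by rewrite !inordK // ltnS ltnW.
  split=> [x|]; first exact: sub.
  have [a [b [Qb zE]]] := loc_frac locL z.
  exists a; first by rewrite /p -zE mulrC idealMr.
  rewrite /p -zE prime_idealrM; case/orP => [|/pQ //]; exact/negP.
have := indep_size_le growT (ppr _) wsP.
by rewrite sws -szs addnC leq_add2l.
Qed.

End RegularLocalization.

Lemma localization_bij (A T L : comNzRingType) (f : {rmorphism A -> T})
    (phi : {rmorphism T -> L}) (Q : T -> Prop) :
  injective f -> (forall t, exists a, f a = t) ->
  is_localization phi Q ->
  is_localization (phi \o f : {rmorphism A -> L}) (fun a => Q (f a)).
Proof.
move=> finj fsurj [U F N I]; split=> [b|z|a c|a].
- exact: U.
- have [a [b]] := F z; have [a' <-] := fsurj a; have [b' <-] := fsurj b.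
  by exists a', b'.
- exact: N.
- by move/I => e; apply: finj; rewrite e rmorph0.
Qed.

(** * Multivariate polynomial rings *)

Lemma mpoly_gen_ind (n : nat) (R : comNzRingType) (S : {mpoly R[n]} -> Prop) :
  (forall c, S c%:MP) -> (forall i, S 'X_i) ->
  (forall p q, S p -> S q -> S (p + q)) -> (forall p q, S p -> S q -> S (p * q)) ->
  forall p, S p.
Proof.
move=> SC SX SD SM; elim/mpolyind => [|c m p _ _ Sp].
  by rewrite -mpolyC0.
apply: (SD) => //; rewrite -mul_mpolyC; apply: (SM) => //.
rewrite mpolyXE_id; elim/big_rec: _ => [|i x _ Sx].
  by rewrite -mpolyC1.
apply: (SM) => //; elim: (m i) => [|d Sd]; first by rewrite expr0 -mpolyC1.
by rewrite exprS; exact: SM.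
Qed.

Lemma mpoly_rmorph_ext (n : nat) (R B : comNzRingType)
    (f g : {rmorphism {mpoly R[n]} -> B}) :
  (forall c, f c%:MP = g c%:MP) -> (forall i, f 'X_i = g 'X_i) -> f =1 g.
Proof.
move=> fgC fgX; apply: mpoly_gen_ind => // p q e e'.
  by rewrite !rmorphD e e'.
by rewrite !rmorphM e e'.
Qed.

Section AddVariable.
Variables (K : fieldType) (n : nat) (A : comNzRingType).
Variable f : {rmorphism A -> {mpoly K[n]}}.
Local Notation widen := (widen_ord (leqnSn n)).

Definition add_variable : {rmorphism {poly A} -> {mpoly K[n.+1]}} :=
  horner_eval ('X_ord_max : {mpoly K[n.+1]}) \o map_poly (@mwiden n K \o f).

Lemma muniX (m : 'X_{1..n.+1}) :
  muni ('X_[m] : {mpoly K[n.+1]}) =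
  'X_[[multinom (m (widen i)) | i < n]] *: 'X^(m ord_max).
Proof. by rewrite muniE msuppX big_seq1 mcoeffX eqxx scale1r. Qed.

Lemma muniX_max : muni ('X_ord_max : {mpoly K[n.+1]}) = 'X.
Proof.
rewrite muniX mnm1E eqxx (_ : [multinom _ | i < n] = 0%MM) ?mpolyX0 ?scale1r //.
by apply/mnmP => i; rewrite mnmE mnm1E mnm0E -val_eqE /= gtn_eqF.
Qed.

Lemma muniX_widen i : muni ('X_(widen i) : {mpoly K[n.+1]}) = ('X_i)%:P.
Proof.
rewrite muniX mnm1E -val_eqE /= ltn_eqF // expr0 -mul_polyC mulr1.
congr ('X_[_])%:P; apply/mnmP => j; rewrite mnmE !mnm1E.
by rewrite -!val_eqE.
Qed.

Lemma muni_mwiden (p : {mpoly K[n]}) : muni (mwiden p) = p%:P.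
Proof.
move: p; apply: (@mpoly_rmorph_ext _ _ _ (@muni n K \o @mwiden n K) polyC).
  by move=> c /=; rewrite mwidenC muniC.
by move=> i /=; rewrite mwidenX mnmwiden1 muniX_widen.
Qed.

Lemma add_variableK p : muni (add_variable p) = map_poly f p.
Proof.
elim/poly_ind: p => [|p c IH]; first by rewrite !rmorph0.
rewrite [in LHS]rmorphD [in LHS]rmorphM [in LHS]muniD [in LHS]muniM IH.
rewrite [in RHS]rmorphD [in RHS]rmorphM /= map_polyX map_polyC /=.
by rewrite /horner_eval map_polyX map_polyC hornerX hornerC muniX_max muni_mwiden.
Qed.

Lemma add_variable_inj : injective f -> injective add_variable.
Proof.
move=> finj p q /(congr1 (@muni n K)); rewrite !add_variableK.
exact: (map_inj_poly finj (rmorph0 f)).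
Qed.

Lemma add_variable_surj :
  (forall t, exists a, f a = t) -> forall t, exists p, add_variable p = t.
Proof.
move=> fsurj.
have mw t : exists p, add_variable p = mwiden t.
  have [a <-] := fsurj t; exists a%:P.
  by rewrite /= /horner_eval map_polyC hornerC.
apply: mpoly_gen_ind => [c|i|_ _ [p <-] [q <-]|_ _ [p <-] [q <-]].
- by have [p pE] := mw c%:MP; exists p; rewrite pE mwidenC.
- case: (unliftP ord_max i) => [j ->|->]; last first.
    by exists 'X; rewrite /= /horner_eval map_polyX hornerX.
  have [p pE] := mw 'X_j; exists p; rewrite pE mwidenX mnmwiden1.
  by congr ('X_[U_(_)]); apply: val_inj; rewrite /= /bump leqNgt ltn_ord.
- by exists (p + q); rewrite rmorphD.
- by exists (p * q); rewrite rmorphM.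
Qed.

End AddVariable.

(** The induction on variables lives on iterated univariate polynomial rings; the
    bijection carries its outcome over. *)
Lemma mpoly_tower (K : fieldType) n :
  exists (A : comNzRingType) (k : {rmorphism K -> A})
         (f : {rmorphism A -> {mpoly K[n]}}),
    [/\ injective f /\ (forall t, exists a, f a = t),
        is_noetherian A, poly_growth k n & regular_dim k n].
Proof.
elim: n => [|n [A [k [f [[finj fsurj] noethA growA regA]]]]].
  exists K, idfun, (@mpolyC 0 K); split.
  - split=> [|t]; first exact: fmorph_inj.
    exists t@_0; apply/mpolyP => m; rewrite mcoeffC.
    have -> : m = 0%MM by apply/mnmP => -[].
    by rewrite eqxx mulr1.
  - exact: noetherian_field.
  - exact: poly_growth_field.
  - exact: regular_dim_field.
exists {poly A}, (polyC \o k), (add_variable f); split.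
- by split; [exact: add_variable_inj | exact: add_variable_surj].
- exact: noetherian_poly.
- exact: poly_growth_poly.
- exact: regular_dim_poly.
Qed.

(** The regularity of affine space: [localization_bij] moves the question to an
    iterated univariate polynomial ring, where [regular_dim_poly] applies. *)
Theorem regular_mpoly_localization (K : fieldType) n (L : comNzRingType)
    (phi : {rmorphism {mpoly K[n]} -> L}) (Q : {mpoly K[n]} -> Prop) :
  is_prime Q -> is_localization phi Q -> regular_local_ring L.
Proof.
move=> primeQ locQ.
have [A [k [f [[finj fsurj] noethA growA regA]]]] := mpoly_tower K n.
have locA := localization_bij finj fsurj locQ.
apply: (regular_local_localization _ locA noethA growA regA).
exact: is_prime_comap.
Qed.

(** * The canonical map to a localization *)

Section LocalizationMap.
Variables (S : comNzRingType) (P : prime_idealr S).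

Definition loc_map (s : S) : localization P :=
  \pi_(localization P) (mkfrac s (notin_prime1 P)).

Lemma loc_map_is_zmod_morphism : zmod_morphism loc_map.
Proof.
move=> x y; rewrite /loc_map.
change (\pi_(localization P) (mkfrac (x - y) (notin_prime1 P)) =
  locadd (\pi_(localization P) (mkfrac x (notin_prime1 P)))
         (locopp (\pi_(localization P) (mkfrac y (notin_prime1 P))))).
rewrite -pi_locopp -pi_locadd; apply: locpi_eq.
by do 3 rewrite /fnum /fden /=; ring.
Qed.

Lemma loc_map_is_monoid_morphism : monoid_morphism loc_map.
Proof.
split=> // x y.
change (loc_map (x * y) = locmul (loc_map x) (loc_map y)).
rewrite /loc_map -pi_locmul; apply: locpi_eq.
by do 3 rewrite /fnum /fden /=; ring.
Qed.

HB.instance Definition _ := GRing.isZmodMorphism.Build S (localization P) loc_map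
  loc_map_is_zmod_morphism.
HB.instance Definition _ := GRing.isMonoidMorphism.Build S (localization P) loc_map
  loc_map_is_monoid_morphism.

Lemma loc_map_unit u : u \notin P -> exists c, loc_map u * c = 1.
Proof.
move=> uP; exists (\pi_(localization P) (mkfrac 1 uP)).
change (locmul (loc_map u) (\pi_(localization P) (mkfrac 1 uP)) = locone P).
rewrite /loc_map -pi_locmul; apply: locpi_eq.
by do 3 rewrite /fnum /fden /=; ring.
Qed.

Lemma loc_map_frac z : exists s u, u \notin P /\ z * loc_map u = loc_map s.
Proof.
elim/quotW: z => -[[s u] /= uP]; exists s, u; split=> //.
change (locmul (\pi_(localization P) (mkfrac s uP)) (loc_map u) = loc_map s).
rewrite /loc_map -pi_locmul; apply: locpi_eq.
by do 3 rewrite /fnum /fden /=; ring.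
Qed.

Lemma loc_map_eq s t : loc_map s = loc_map t ->
  exists2 u, u \notin P & u * (s - t) = 0.
Proof.
by move/locpiP => [u uP]; rewrite /fnum /fden /= !mulr1; exists u.
Qed.

Lemma loc_map_nonunit s c : s \in P -> loc_map s * c <> 1.
Proof.
move=> sP; have [t [u [uP cu]]] := loc_map_frac c => sc.
have : loc_map (s * t) = loc_map u by rewrite rmorphM /= -cu mulrA sc mul1r.
case/loc_map_eq => v vP; rewrite mulrBr => /subr0_eq e.
have : v * (s * t) \in P by rewrite mulrCA mulrC idealMr.
by rewrite e prime_idealrM (negbTE vP) (negbTE uP).
Qed.

(** If S becomes a ring of fractions of the image of T already with denominators
    outside P, then T and S have the same localization at P. The second hypothesis
    says that sigma stays injective in that localization. *)
Lemma is_localization_through (T : comNzRingType) (sigma : {rmorphism T -> S}) :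
  (forall s, exists a b, sigma b \notin P /\ s * sigma b = sigma a) ->
  (forall u a, u \notin P -> u * sigma a = 0 -> a = 0) ->
  is_localization (loc_map \o sigma : {rmorphism T -> localization P})
    (fun a => sigma a \in P).
Proof.
move=> fracS injS; split=> [b /negP|z|a c|a /= e].
- exact: loc_map_unit.
- have [s [u [uP zE]]] := loc_map_frac z.
  have [a [b [bP sE]]] := fracS s; have [a' [b' [bP' uE]]] := fracS u.
  exists (a * b'), (a' * b); split.
    by apply/negP; rewrite rmorphM -uE notin_primeM // notin_primeM.
  by rewrite /= !(rmorphM, =^~ uE, =^~ sE) /= -zE; ring.
- exact: loc_map_nonunit.
- have [|u uP] := @loc_map_eq (sigma a) 0; first by rewrite rmorph0.
  by rewrite subr0; exact: injS.
Qed.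

End LocalizationMap.

(** * Two-minors *)

Lemma det2 (A : comNzRingType) (M : 'M[A]_2) :
  \det M = M ord0 ord0 * M ord_max ord_max - M ord0 ord_max * M ord_max ord0.
Proof.
rewrite (expand_det_row _ ord0) !big_ord_recl big_ord0 /cofactor !det_mx11 !mxE.
have -> : lift ord0 ord0 = ord_max :> 'I_2 by apply: val_inj.
have -> : lift ord_max ord0 = ord0 :> 'I_2 by apply: val_inj.
by rewrite /= expr0 expr1; ring.
Qed.

(** Rows and columns may come in any order, and may coincide: exchanging two of
    them only changes the sign. *)
Lemma minor2_in_ideal (A : comNzRingType) p q (M : 'M[A]_(p, q)) i i' j j' :
  M i j * M i' j' - M i j' * M i' j \in minors_ideal 2 M.
Proof.
have II : is_ideal (fun x => x \in minors_ideal 2 M) := is_ideal_gen _.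
have lt_minor (u u' : 'I_p) (v v' : 'I_q) : (u < u')%N -> (v < v')%N ->
    M u v * M u' v' - M u v' * M u' v \in minors_ideal 2 M.
  move=> lt_u lt_v; apply: mem_ideal_gen.
  exists (fun k : 'I_2 => if k == ord0 then u else u').
  exists (fun k : 'I_2 => if k == ord0 then v else v').
  split; last by rewrite det2 !mxE.
    by case=> -[|[|//]] ? [] [|[|//]] ?.
  by case=> -[|[|//]] ? [] [|[|//]] ?.
have lt_rows (u u' : 'I_p) (v v' : 'I_q) : (u < u')%N ->
    M u v * M u' v' - M u v' * M u' v \in minors_ideal 2 M.
  move=> lt_u.
  have [|/(lt_minor _ _ _ _ lt_u)/(ideal_opp II)|/val_inj->] := ltngtP v v'.
  - exact: lt_minor.
  - by rewrite opprB.
  - by rewrite subrr; case: II.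
have [|/(lt_rows _ _ j j')/(ideal_opp II)|/val_inj->] := ltngtP i i'.
- exact: lt_rows.
- by rewrite opprB mulrC [X in _ - X]mulrC.
- by rewrite mulrC subrr; case: II.
Qed.

Lemma minors2_rank_one (A B : comNzRingType) (f : {rmorphism A -> B})
    p q (M : 'M[A]_(p, q)) (a : 'I_p -> B) (b : 'I_q -> B) x :
  (forall i j, f (M i j) = a i * b j) -> x \in minors_ideal 2 M -> f x = 0.
Proof.
move=> Mab; apply: (@ideal_gen_min _ (fun x => f x = 0)).
  split=> [|c u v u0 v0]; first exact: rmorph0.
  by rewrite rmorphD rmorphM /= u0 v0 mulr0 addr0.
move=> _ [g [h [_ _ ->]]].
by rewrite det2 rmorphB !rmorphM /= !mxE !Mab; ring.
Qed.

(** * Primes other than the irrelevant ideal *)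

Section MaximalIdeal.
Variables (K : fieldType) (N : nat) (I : idealr {mpoly K[N]}).
Local Notation S := {ideal_quot I}.
Local Notation hmax := (@homogeneous_maximal_ideal K N I).

Lemma mod_homogeneous_maximal (p : {mpoly K[N]}) :
  exists c, \pi_S (p - c%:MP) \in hmax.
Proof.
have IM : is_ideal (fun s => s \in hmax) := is_ideal_gen _.
move: p; apply: mpoly_gen_ind => [c|i|p q [c cP] [d dP]|p q [c cP] [d dP]].
- by exists c; rewrite subrr rmorph0; case: IM.
- by exists 0; rewrite mpolyC0 subr0; apply: mem_ideal_gen; exists i.
- exists (c + d); rewrite mpolyCD opprD addrACA rmorphD.
  exact: (ideal_add_closed IM).
- exists (c * d); rewrite mpolyCM.
  have -> : p * q - c%:MP * d%:MP = p * (q - d%:MP) + d%:MP * (p - c%:MP) by ring.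
  rewrite rmorphD !rmorphM.
  by apply: (ideal_add_closed IM); exact: (ideal_mulr _ IM).
Qed.

(** A prime containing all the variables contains the irrelevant ideal, which is
    already maximal. *)
Lemma variable_notin_prime (P : prime_idealr S) :
  ~ (P =i hmax) -> exists v, \pi_S 'X_v \notin P.
Proof.
move=> Pnmax; apply: contrapT => /forallNP allP; apply: Pnmax => s.
have maxP t : t \in hmax -> t \in P.
  apply: (ideal_gen_min (is_ideal_idealr P)) => _ [v ->].
  by apply: contrapT => /negP; exact: allP.
apply/idP/idP => [|/maxP //].
elim/quotW: s => p pP; have [c cP] := mod_homogeneous_maximal p.
have cinP : \pi_S c%:MP \in P.
  rewrite -[c%:MP](subKr p) rmorphB rpredB //; exact: maxP.
have [c0|c0] := eqVneq c 0; first by rewrite c0 mpolyC0 subr0 in cP.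
have := idealMr (\pi_S c^-1%:MP) cinP.
by rewrite -rmorphM -mpolyCM mulVf // mpolyC1 rmorph1 idealr1.
Qed.

End MaximalIdeal.

(** * The affine chart where one entry is invertible *)

(** The entry x at position (l0, i0, j0) is made invertible. *)
Section Chart.
Variables (K : fieldType) (r m n : nat).
Variables (l0 : 'I_r) (i0 : 'I_m) (j0 : 'I_n).

Local Notation I := (toric_ddet_ideal K r m n).
Local Notation R := {mpoly K[ddet_nvars r m n]}.
Local Notation S := {ideal_quot I}.

Definition entry l i j : R := 'X_(enum_rank (l, i, j)).
Definition coord l i j : S := \pi_S (entry l i j).

Lemma coord_swap_H l l' i i' j j' :
  coord l i j * coord l' i' j' = coord l' i j' * coord l i' j.
Proof.
apply/subr0_eq; rewrite /coord -!rmorphM -rmorphB /=.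
apply/eqP; rewrite -(rmorph0 (\pi_S)) -Quotient.idealrBE subr0.
have HE a b c : ddet_H K r m n b (tagnat.Rank a c) = entry a b c.
  by have /matrixP/(_ b c) := mxrowK (@ddet_mx K r m n) a; rewrite !mxE.
apply/ideal_addP.
exists (entry l i j * entry l' i' j' - entry l' i j' * entry l i' j), 0.
split; rewrite ?ideal_gen0 ?addr0 // -!HE.
exact: minor2_in_ideal.
Qed.

Lemma coord_swap_V l l' i i' j j' :
  coord l i j * coord l' i' j' = coord l i j' * coord l' i' j.
Proof.
apply/subr0_eq; rewrite /coord -!rmorphM -rmorphB /=.
apply/eqP; rewrite -(rmorph0 (\pi_S)) -Quotient.idealrBE subr0.
have VE a b c : ddet_V K r m n (tagnat.Rank a b) c = entry a b c.
  by have /matrixP/(_ b c) := mxcolK (@ddet_mx K r m n) a; rewrite !mxE.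
apply/ideal_addP.
exists 0, (entry l i j * entry l' i' j' - entry l i j' * entry l' i' j).
split; rewrite ?ideal_gen0 ?add0r // -!VE.
exact: minor2_in_ideal.
Qed.

(** On the chart every entry is a monomial x^-2 a_i b_j c_l in the entries that
    differ from x in one index only: [coord_swap_H] separates the row index from
    the other two, and [coord_swap_V] then separates these. *)
Lemma coord_monomial l i j :
  coord l i j * coord l0 i0 j0 ^+ 2 =
  coord l0 i j0 * coord l0 i0 j * coord l i0 j0.
Proof.
rewrite expr2 mulrA (coord_swap_H l l0 i i0 j j0) -mulrA.
by rewrite (coord_swap_V l l0 i0 i0 j j0) [coord l i0 j0 * _]mulrC mulrA.
Qed.

(** The positions that differ from the base position in at most one index. Their
    entries are free coordinates on the chart, one of them being x itself. *)
Definition on_axis (t : 'I_r * 'I_m * 'I_n) : bool :=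
  let: (l, i, j) := t in
  [|| (i == i0) && (j == j0), (l == l0) && (j == j0) | (l == l0) && (i == i0)].

Local Notation axes := {t | on_axis t}.
Local Notation T := {mpoly K[#|{: axes}|]}.

(** Total on positions, so that entries can be written without proofs of
    [on_axis]; the default value 0 is never met. *)
Definition axis_var t : T :=
  if insub t is Some u then 'X_(enum_rank (u : axes)) else 0.

Definition axes_to_entries : {rmorphism T -> R} :=
  mmap (@mpolyC _ K) (fun v => 'X_(enum_rank (val (enum_val v : axes)))).

Definition chart_ring_map : {rmorphism T -> S} := \pi_S \o axes_to_entries.

(** The expression of an entry in the coordinates of the chart. *)
Definition entry_value (t : 'I_r * 'I_m * 'I_n) : {fraction T} :=
  let: (l, i, j) := t in
  tofrac (axis_var (l0, i, j0)) * tofrac (axis_var (l0, i0, j)) *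
  tofrac (axis_var (l, i0, j0)) / tofrac (axis_var (l0, i0, j0)) ^+ 2.

(** The rational parametrization of the variety. Since it kills the defining
    ideal and restricts to the inclusion on the axes, it shows that the chart
    coordinates satisfy no relation. *)
Definition parametrization : {rmorphism R -> {fraction T}} :=
  mmap (@tofrac T \o @mpolyC _ K) (fun v => entry_value (enum_val v)).

Lemma axis_varE (u : axes) : axis_var (val u) = 'X_(enum_rank u).
Proof. by rewrite /axis_var valK. Qed.

Lemma on_axis0 : on_axis (l0, i0, j0). Proof. by rewrite /on_axis !eqxx. Qed.

Lemma axes_to_entries_var t :
  on_axis t -> axes_to_entries (axis_var t) = 'X_(enum_rank t).
Proof.
move=> tJ; rewrite -[t]/(val (Sub t tJ : axes)) axis_varE /= mmapX mmap1U.
by rewrite enum_rankK.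
Qed.

Lemma axis_var0_neq0 : axis_var (l0, i0, j0) != 0.
Proof.
apply/eqP => /(congr1 axes_to_entries).
rewrite (axes_to_entries_var on_axis0) rmorph0.
move/(congr1 (mcoeff U_(enum_rank (l0, i0, j0))))/eqP.
by rewrite mcoeffX eqxx mcoeff0 oner_eq0.
Qed.

Lemma parametrization_entry l i j :
  parametrization (entry l i j) = entry_value (l, i, j).
Proof. by rewrite /= mmapX mmap1U enum_rankK. Qed.

Lemma parametrization_axes p : parametrization (axes_to_entries p) = tofrac p.
Proof.
move: p; apply: (@mpoly_rmorph_ext _ _ _
  (parametrization \o axes_to_entries) (@tofrac T)).
  by move=> c; rewrite /= mmapC mmapC.
move=> v; rewrite -(enum_valK v); move: (enum_val v) => u.
rewrite -axis_varE; move: (valP u); move: (val u) => [[l i] j] uJ.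
rewrite [LHS](_ : _ = parametrization (entry l i j)); last first.
  by rewrite /entry -(axes_to_entries_var uJ).
rewrite parametrization_entry /entry_value.
have z0 : tofrac (axis_var (l0, i0, j0)) ^+ 2 != 0.
  by rewrite expf_neq0 // tofrac_eq0 axis_var0_neq0.
move: uJ => /or3P[] /andP[/eqP -> /eqP ->].
- by rewrite -expr2 mulrC mulKf.
- by rewrite -[X in X / _]mulrA -expr2 mulfK.
- by rewrite [X in X / _]mulrAC -expr2 mulrC mulKf.
Qed.

(** The parametrized H and V have rank one: their entries factor as a_i times
    x^-2 b_j c_l, and as x^-2 a_i c_l times b_j. *)
Lemma parametrization_ideal x : x \in I -> parametrization x = 0.
Proof.
move=> /ideal_addP[y [z [yH zV ->]]].
pose a i := tofrac (axis_var (l0, i, j0)).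
pose b j := tofrac (axis_var (l0, i0, j)).
pose c l := tofrac (axis_var (l, i0, j0)).
pose d := tofrac (axis_var (l0, i0, j0)) ^+ 2.
rewrite rmorphD /=.
rewrite (minors2_rank_one (f := parametrization) (a := a)
  (b := fun k => b (tagnat.sig2 k) * c (tagnat.sig1 k) / d) _ yH).
rewrite (minors2_rank_one (f := parametrization)
  (a := fun k => a (tagnat.sig2 k) * c (tagnat.sig1 k) / d) (b := b) _ zV) ?addr0 //.
- by move=> i j; rewrite !mxE parametrization_entry /= /a /b /c /d; ring.
- by move=> i j; rewrite !mxE parametrization_entry /= /a /b /c /d; ring.
Qed.

Lemma chart_clear_denominators (s : S) :
  exists e a, s * coord l0 i0 j0 ^+ e = chart_ring_map a.
Proof.
have cA t : on_axis t -> chart_ring_map (axis_var t) = \pi_S 'X_(enum_rank t).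
  by move=> tJ; rewrite -(axes_to_entries_var tJ).
elim/quotW: s; apply: mpoly_gen_ind => [c|v|p q|p q].
- by exists 0, c%:MP; rewrite expr0 mulr1 /= mmapC.
- rewrite -(enum_valK v); case: (enum_val v) => -[l i] j.
  exists 2, (axis_var (l0, i, j0) * axis_var (l0, i0, j) * axis_var (l, i0, j0)).
  rewrite !rmorphM !cA /on_axis ?eqxx ?orbT //.
  exact: coord_monomial.
- move=> [e [a ea]] [f [b fb]].
  exists (e + f)%N.
  exists (a * axis_var (l0, i0, j0) ^+ f + b * axis_var (l0, i0, j0) ^+ e).
  rewrite !rmorphD !rmorphM !rmorphXn !(cA _ on_axis0) -ea -fb exprD.
  by rewrite -[\pi_S 'X__]/(coord l0 i0 j0); ring.
- move=> [e [a ea]] [f [b fb]]; exists (e + f)%N, (a * b).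
  by rewrite !rmorphM -ea -fb exprD; ring.
Qed.

(** A relation between chart coordinates that holds after inverting some u outside
    P gives, once u is multiplied by a power of x, a product w a that the
    parametrization kills; then w a = 0, while w is nonzero because u is not in
    P. *)
Lemma chart_localization (P : prime_idealr S) : coord l0 i0 j0 \notin P ->
  is_localization (@loc_map _ P \o chart_ring_map : {rmorphism T -> localization P})
    (fun a => chart_ring_map a \in P).
Proof.
move=> x0P.
have powP e : coord l0 i0 j0 ^+ e \notin P.
  by elim: e => [|e IH]; [rewrite expr0 notin_prime1 | rewrite exprS notin_primeM].
apply: is_localization_through => [s|u a uP ua0].
  have [e [a sE]] := chart_clear_denominators s.
  exists a, (axis_var (l0, i0, j0) ^+ e); rewrite rmorphXn.
  have -> : chart_ring_map (axis_var (l0, i0, j0)) = coord l0 i0 j0.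
    by rewrite -[LHS]/(\pi_S _) (axes_to_entries_var on_axis0).
  by split.
have [e [w uE]] := chart_clear_denominators u.
have wP : chart_ring_map w \notin P by rewrite -uE notin_primeM.
have /eqP : chart_ring_map (w * a) = 0 by rewrite rmorphM -uE mulrAC ua0 mul0r.
rewrite -(rmorph0 (\pi_S)) -[X in X == _]/(\pi_S _) -Quotient.idealrBE subr0.
move/parametrization_ideal; rewrite parametrization_axes => /eqP.
rewrite tofrac_eq0 mulf_eq0 => /orP[/eqP w0|/eqP //].
by rewrite w0 rmorph0 idealr0 in wP.
Qed.

End Chart.

(** * Smoothness *)

Theorem theorem3p2 (K : fieldType) (r m n : nat)
  (perfK : perfect_field K) (r2 : (2 <= r)%N) (m2 : (2 <= m)%N)
  (n2 : (2 <= n)%N) :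
  smooth_projective (toric_ddet_ideal K r m n).
Proof.
move=> P _ /variable_notin_prime[v]; rewrite -(enum_valK v).
case: (enum_val v) => -[l0 i0] j0 x0P.
apply: (regular_mpoly_localization _ (chart_localization x0P)).
exact: (is_prime_comap _ (is_prime_idealr P)).
Qed.
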